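(* Let $K$ be a field of characteristic $p>0$, and $S=K[x_1,\ldots,x_n]$. If $f\in S$ is an irreducible square-free supported polynomial, then $S/(f)$ is geometrically F-rational.
   Context: A polynomial $f\in S=K[x_1,\ldots,x_n]$ is square-free supported if every monomial appearing in $f$ with non-zero coefficient is square-free (equivalently, $f$ has degree at most one in each variable). A Noetherian ring $R$ of prime characteristic $p$ is F-rational if every parameter ideal of $R$ is tightly closed. An ideal $I=(r_1,\ldots,r_m)$ of $R$ is a parameter ideal if for every prime ideal $\mathfrak p\supseteq I$ the images of $r_1,\ldots,r_m$ in $R_{\mathfrak p}$ form part of a system of parameters of $R_{\mathfrak p}$. An ideal $I$ is tightly closed if $I=I^*$, where $I^*$ is the set of $r\in R$ for which there is $c\in R$ not in any minimal prime of $R$ with $cr^{p^e}\in I^{[p^e]}$ for all $e\gg 0$; here $I^{[p^e]}$ is the ideal generated by the $p^e$-th powers of elements of $I$. For $R=K[x_1,\ldots,x_n]/I$, $R$ is geometrically F-rational if $R\otimes_K L$ is F-rational for every field extension $L$ of $K$. *)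

(* Defs.v *)
From HB Require Import structures.
From mathcomp Require Import all_boot all_order all_algebra.
From mathcomp Require Import boolp classical_sets.
From mathcomp Require Import mpoly.

Set Implicit Arguments.
Unset Strict Implicit.
Unset Printing Implicit Defensive.

Import GRing.Theory.

Local Open Scope classical_set_scope.
Local Open Scope ring_scope.
Local Open Scope quotient_scope.

Section Ideals.
Variable R : comNzRingType.
Implicit Types (I P Q : set R).

Definition is_ideal I : Prop :=
  [/\ I 0, forall x y, I x -> I y -> I (x + y) & forall a x, I x -> I (a * x)].

Definition ideal_gen (A : set R) : set R := smallest is_ideal A.

Definition radical I : set R := [set x | exists k : nat, I (x ^+ k)].

Definition is_proper_ideal I : Prop := is_ideal I /\ ~ I 1.

Definition is_prime_ideal P : Prop :=
  is_proper_ideal P /\ forall x y, P (x * y) -> P x \/ P y.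

Definition is_minimal_prime P : Prop :=
  is_prime_ideal P /\ forall Q, is_prime_ideal Q -> Q `<=` P -> Q = P.

Definition noetherian : Prop :=
  forall I, is_ideal I -> exists s : seq R, I = ideal_gen [set` s].

Definition prime_chain (d : nat) (C : nat -> set R) : Prop :=
  (forall i, (i <= d)%N -> is_prime_ideal (C i)) /\
  (forall i, (i < d)%N -> C i `<` C i.+1).

Definition has_krull_dim (d : nat) : Prop :=
  (exists C, prime_chain d C) /\ forall e C, prime_chain e C -> (e <= d)%N.

End Ideals.

Arguments noetherian : clear implicits.
Arguments has_krull_dim : clear implicits.

(* [phi : R -> A] exhibits A as the localization of R at the prime P. The
   converse of the last clause follows from the first one. *)
Definition is_localization (R : comNzRingType) (P : set R)
    (A : comUnitRingType) (phi : {rmorphism R -> A}) : Prop :=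
  [/\ forall s, ~ P s -> phi s \is a GRing.unit,
      forall a, exists r s, ~ P s /\ a = phi r / phi s
    & forall r, phi r = 0 -> exists s, ~ P s /\ s * r = 0].

(* For a local ring A: dim A elements generating an ideal which is primary to
   the maximal ideal, i.e. whose radical is the set of non-units. *)
Definition is_sop (A : comUnitRingType) (s : seq A) : Prop :=
  has_krull_dim A (size s) /\
  radical (ideal_gen [set` s]) = [set x : A | x \isn't a GRing.unit].

(* Localizations exist and are unique up to isomorphism, so quantifying over
   all models A of the localization R_P is the same as fixing one. *)
Definition is_parameter_ideal (R : comNzRingType) (I : set R) : Prop :=
  exists s : seq R, I = ideal_gen [set` s] /\
    forall P : set R, is_prime_ideal P -> I `<=` P ->
    forall (A : comUnitRingType) (phi : {rmorphism R -> A}),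
      is_localization P phi -> exists t : seq A, is_sop (map phi s ++ t).

Definition frobenius_power (R : comNzRingType) (I : set R) (q : nat) : set R :=
  ideal_gen [set x ^+ q | x in I].

Definition tight_closure (p : nat) (R : comNzRingType) (I : set R) : set R :=
  [set r | exists c : R, (forall P, is_minimal_prime P -> ~ P c) /\
     exists e0 : nat, forall e, (e0 <= e)%N ->
       frobenius_power I (p ^ e) (c * r ^+ (p ^ e))].

Definition F_rational (p : nat) (R : comNzRingType) : Prop :=
  [/\ p \in [pchar R], noetherian R
    & forall I : set R, is_parameter_ideal I -> tight_closure p I = I].

(* T, with the maps u and v, is the tensor product of the K-algebras A and B,
   expressed as their coproduct among commutative K-algebras. Testing against
   nonzero rings C only is enough, and T itself is nonzero whenever K is a
   field. *)
Definition is_tensor_product (K A B T : comNzRingType)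
    (a : {rmorphism K -> A}) (b : {rmorphism K -> B})
    (u : {rmorphism A -> T}) (v : {rmorphism B -> T}) : Prop :=
  (forall k, u (a k) = v (b k)) /\
  forall (C : comNzRingType) (f : {rmorphism A -> C}) (g : {rmorphism B -> C}),
    (forall k, f (a k) = g (b k)) ->
    exists h : {rmorphism T -> C},
      [/\ forall x, h (u x) = f x, forall y, h (v y) = g y
        & forall h' : {rmorphism T -> C},
            (forall x, h' (u x) = f x) -> (forall y, h' (v y) = g y) ->
            h' =1 h].

(* R is a K-algebra through its structure map [a], and T stands for the tensor
   product of R and L over K, which is unique up to isomorphism. *)
Definition geometrically_F_rational (p : nat) (K : fieldType)
    (R : comNzRingType) (a : {rmorphism K -> R}) : Prop :=
  forall (L : fieldType) (i : {rmorphism K -> L}),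
  exists (T : comNzRingType) (u : {rmorphism R -> T}) (v : {rmorphism L -> T}),
    is_tensor_product a i u v /\ F_rational p T.

(* The library forms quotients by boolean predicates with an [idealr]
   structure; the properness proof makes the quotient a nonzero ring. *)
Section Quotient.
Variables (R : comNzRingType) (I : set R) (properI : is_proper_ideal I).

Definition ideal_pred of is_proper_ideal I : R -> bool := fun x => x \in I.

Let idealP : idealr_closed (ideal_pred properI).
Proof.
have [[I0 ID IM] I1] := properI; split.
- by rewrite unfold_in; apply/asboolP.
- by rewrite unfold_in; apply/asboolPn.
- move=> a x y; rewrite !unfold_in => /asboolP Ix /asboolP Iy.
  by apply/asboolP/ID => //; exact: IM.
Qed.

HB.instance Definition _ := isIdealr.Build R (ideal_pred properI) idealP.

Definition quotient_ring : comNzRingType := {ideal_quot (ideal_pred properI : idealr R)}.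

Definition quotient_map : {rmorphism R -> quotient_ring} := \pi_quotient_ring.

End Quotient.

Definition is_irreducible (R : comUnitRingType) (f : R) : Prop :=
  [/\ f != 0, f \isn't a GRing.unit
    & forall g h, f = g * h -> g \is a GRing.unit \/ h \is a GRing.unit].

Lemma irreducible_proper (R : comUnitRingType) (f : R) :
  is_irreducible f -> is_proper_ideal (ideal_gen [set f]).
Proof.
case=> _ nuf _; split.
  split=> [J [[]]|x y Jx Jy J JP|a x Jx J JP] //.
    by case: (JP) => -[_ JD _] _; apply: JD; [exact: Jx|exact: Jy].
  by case: (JP) => -[_ _ JM] _; apply: JM; exact: Jx.
move=> /(_ [set x | exists h, x = h * f]); case.
  split; last by move=> _ ->; exists 1; rewrite mul1r.
  split; first by exists 0; rewrite mul0r.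
    by move=> _ _ [g ->] [h ->]; exists (g + h); rewrite mulrDl.
  by move=> a _ [h ->]; exists (a * h); rewrite mulrA.
move=> h eq1; case/negP: nuf; apply/unitrP; exists h.
by rewrite [f * h]mulrC -eq1.
Qed.

Section Hypersurface.
Variables (K : fieldType) (n : nat) (f : {mpoly K[n]}).
Hypothesis irr_f : is_irreducible f.

Definition hypersurface_ring : comNzRingType :=
  quotient_ring (irreducible_proper irr_f).

Definition hypersurface_coef : {rmorphism K -> hypersurface_ring} :=
  quotient_map (irreducible_proper irr_f) \o @mpolyC n K.

End Hypersurface.

Definition squarefree_supported (K : fieldType) (n : nat) (f : {mpoly K[n]})
    : Prop :=
  forall m : 'X_{1..n}, m \in msupp f -> forall i : 'I_n, (m i <= 1)%N.

(* Main.v *)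
Require Import Defs.
From HB Require Import structures.
From mathcomp Require Import all_boot all_order all_algebra fraction.
From mathcomp Require Import boolp classical_sets.
From mathcomp Require Import mpoly ring zify.

(** Let [S = K[x_1..x_n]] and let [f] be irreducible and squarefree supported.
    A [q]-linear map is an additive [psi : S -> S] with
    [psi (a^q b) = a psi b], and [c] splits if some [psi c = 1]. The heart of
    the proof is [sqf_irreducible_splits]: for every [c] outside [(f)] there are
    arbitrarily large [q = p^e] for which [c f^(q-1)] splits. This is strong
    F-regularity of [S/(f)], and it makes every ideal of [S/(f)] tightly closed:
    lift [c r^q] in [I^[q]] to [S], multiply by [f^(q-1)] and apply [psi]; the
    result says that [r] lies in [I]. Parameter ideals are a special case.

    The splitting is built by induction on the number of variables. Write
    [f = g X + h] with [g] and [h] free of the last variable [X]. If [g = 0],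
    the induction hypothesis applies to a coefficient of [c] outside [(h)].
    Otherwise the open set [g <> 0] of the hypersurface is the graph of
    [X = - h/g], hence an open set of an affine space, where splittings are
    plentiful ([mpoly_splits]). This reduces an arbitrary [c] to [c = g]
    ([reduce_to_leading_coef]). For [c = g], freeze [X] at a transcendental
    [t]: the polynomial [f_t = g t + h] has one variable less, and in terms of
    [X - t] the lowest coefficient of [g f^(q-1)] is [g f_t^(q-1)], so a
    splitting of the latter over [K(t)] gives one of the former. It then
    descends to [K] along a [K]-linear retraction of [K(t)]
    ([field_retraction], which for imperfect [K] also provides the one-sided
    inverse of Frobenius behind all splittings).

    The induction needs [f_t] to be irreducible over [K(t)] (or a unit) and not
    to divide [g]. Here squarefreeness is essential: two factors of a
    squarefree supported polynomial have disjoint sets of variables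
    ([sqf_factor_supported]), so a factorization says that the coefficients,
    arranged as a matrix indexed by the monomials in either set, have rank one.
    Rank one is a system of equations with coefficients in the prime ring,
    which descends from any extension field ([map_mpoly_irreducible]); and a
    rank one matrix whose entries are linear forms in [t] is a constant vector
    times a vector of linear forms ([pencil_rank_one]), so a factorization of
    [f_t] yields one of [f].

    Irreducibility is also turned into primality ([sqf_irreducible_prime]), so
    that [0] is the minimal prime of [S/(f)]. Since [f] stays irreducible over
    every extension [L] of [K], all this applies to [L[x]/(f)], which is the
    base change of [S/(f)] to [L]; it is Noetherian by Hilbert's basis
    theorem. *)

Set Implicit Arguments.
Unset Strict Implicit.
Unset Printing Implicit Defensive.

Import GRing.Theory.

Local Open Scope ring_scope.

(** * Frobenius-linear maps *)

(** For [q] a power of the characteristic, these are the [A]-linear maps to [A]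
    from [A] viewed as a module over itself through the [q]-th power map. *)
Definition frob_linear (q : nat) (A : comNzRingType) (psi : A -> A) : Prop :=
  (forall x y, psi (x + y) = psi x + psi y)
  /\ (forall a x, psi (a ^+ q * x) = a * psi x).

(** Such a [psi] splits the [A]-linear map, from [A] to its pushforward under the
    [q]-th power map, that sends [1] to [a]. *)
Definition splits (q : nat) (A : comNzRingType) (a : A) : Prop :=
  exists2 psi : A -> A, frob_linear q psi & psi a = 1.

Section FrobLinear.
Variables (A : comNzRingType).
Implicit Types (q : nat) (psi : A -> A).

Lemma frob_linear0 q psi : frob_linear q psi -> psi 0 = 0.
Proof. by case=> D _; apply: (addrI (psi 0)); rewrite -D !addr0. Qed.

Lemma frob_linear_comp q1 q2 psi1 psi2 :
  frob_linear q1 psi1 -> frob_linear q2 psi2 ->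
  frob_linear (q1 * q2) (fun x => psi1 (psi2 x)).
Proof.
move=> [D1 M1] [D2 M2]; split=> [x y|a x]; first by rewrite D2 D1.
by rewrite exprM M2 M1.
Qed.

Lemma frob_linear_premul q psi c :
  frob_linear q psi -> frob_linear q (fun x => psi (c * x)).
Proof.
by move=> [D M]; split=> [x y|a x]; rewrite ?mulrDr ?D // mulrCA M.
Qed.

Lemma frob_linear_combine q psi1 psi2 b :
  frob_linear q psi1 -> frob_linear q psi2 ->
  frob_linear q (fun x => psi1 x + b * psi2 x).
Proof.
move=> [D1 M1] [D2 M2]; split=> [x y|a x]; first by rewrite D1 D2 mulrDr addrACA.
by rewrite M1 M2 mulrDr mulrCA.
Qed.

End FrobLinear.

Lemma splits_iso q (A B : comNzRingType) (f : {rmorphism A -> B})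
    (g : {rmorphism B -> A}) (a : A) :
  cancel f g -> splits q (f a) -> splits q a.
Proof.
move=> fK [psi [D M] E]; exists (fun x => g (psi (f x))).
  by split=> [x y|b x]; rewrite ?rmorphD ?D ?rmorphD // rmorphM rmorphXn M rmorphM fK.
by rewrite E rmorph1.
Qed.

Section LiftPoly.
Variables (A : comNzRingType) (p e : nat).
Hypothesis charA : p \in [pchar A].
Local Notation q := (p ^ e)%N.

Lemma pexp_gt0 : (0 < q)%N.
Proof. by rewrite expn_gt0 prime_gt0 // (pcharf_prime charA). Qed.

Lemma exprD_pchar (B : comNzRingType) (x y : B) : p \in [pchar B] ->
  (x + y) ^+ q = x ^+ q + y ^+ q.
Proof.
move=> charB; apply: exprDn_pchar.
by rewrite pnatX (pnatE _ (pcharf_prime charB)) charB.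
Qed.

Definition lift_poly k (psi : A -> A) (c : {poly A}) : {poly A} :=
  \poly_(j < size c) psi c`_(k + j * q).

Lemma coef_lift_poly k psi c j : frob_linear q psi ->
  (lift_poly k psi c)`_j = psi c`_(k + j * q).
Proof.
move=> L; rewrite coef_poly; case: ltnP => // le_cj.
rewrite [c`__]nth_default ?(frob_linear0 L) //.
by rewrite (leq_trans le_cj) // (leq_trans (leq_pmulr _ pexp_gt0)) // leq_addl.
Qed.

(** [A[X]] is free over [A[X^q]] with basis the powers [X^k], [k < q]; projecting
    to the coefficient of one of them and then applying [psi] coefficientwise
    is [q]-linear. *)
Lemma lift_poly_frob_linear k psi : (k < q)%N ->
  frob_linear q psi -> frob_linear q (lift_poly k psi).
Proof.
move=> lt_kq L; have [D M] := L; have cE := coef_lift_poly k _ _ L.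
have LD x y : lift_poly k psi (x + y) = lift_poly k psi x + lift_poly k psi y.
  by apply/polyP=> j; rewrite coefD !cE coefD D.
split=> // a; have charPA : p \in [pchar {poly A}] by rewrite pchar_poly.
elim/poly_ind: a => [|a b IH] x.
  rewrite expr0n eqn0Ngt pexp_gt0 /= !mul0r.
  by apply/polyP=> j; rewrite cE !coef0 (frob_linear0 L).
rewrite exprD_pchar // !mulrDl LD; congr (_ + _); last first.
  by apply/polyP=> j; rewrite cE -polyC_exp !coefCM cE M.
rewrite exprMn -mulrA IH -mulrA; congr (_ * _).
apply/polyP=> j; (* multiplication by X^q shifts the selected coefficients k + j q by one step *)
rewrite cE coefXnM coefXM; case: j => [|j] /=.
  by rewrite mul0n addn0 lt_kq (frob_linear0 L).
rewrite cE mulSn addnCA ltnNge leq_addr /=.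
by rewrite addKn.
Qed.

End LiftPoly.

(** * Retractions, and splittings of nonzero polynomials *)

Definition retraction (A B : comNzRingType) (i : {rmorphism A -> B})
    (rho : B -> A) : Prop :=
  [/\ forall x y, rho (x + y) = rho x + rho y,
      forall a x, rho (i a * x) = a * rho x & rho 1 = 1].

(** A retraction is the projection to [K 1] along a complementary hyperplane. Zorn's
    lemma gives a [K]-subspace maximal among those avoiding [1], and maximality
    forces it to be such a hyperplane. *)
Lemma field_retraction (K M : fieldType) (i : {rmorphism K -> M}) :
  exists rho : M -> K, retraction i rho.
Proof.
pose P (W : set M) := ~ W 1 /\ forall a x y, W x -> W y -> W (i a * x + y).
have [|W [[W1 WL] Wmax]] := @Zorn_bigcup M P.
  move=> F FP Ftot; split=> [[X FX X1]|a x y [X FX Xx] [Y FY Yy]].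
    by case: (FP X FX).
  have [XY|YX] := Ftot X Y FX FY.
    by exists Y => //; apply: (FP Y FY).2 => //; exact: XY.
  by exists X => //; apply: (FP X FX).2 => //; exact: YX.
have W0 : W 0.
  apply: contrapT => nW0; apply: (Wmax (fun x => x = 0 \/ W x)).
    split=> [x Wx|W0x]; first by right.
    by apply: nW0; apply: W0x; left.
  split=> [[/eqP|//]|]; first by rewrite oner_eq0.
  move=> a x y [->|Wx] [->|Wy]; rewrite ?mulr0 ?add0r ?addr0; [by left|by right| |].
    right; suff -> : i a * x = i (a - 1) * x + x by exact: WL.
    by rewrite rmorphB rmorph1 mulrBl mul1r subrK.
  by right; exact: WL.
have WZ a x : W x -> W (i a * x) by move=> Wx; rewrite -[_ * x]addr0; exact: WL.
have WD x y : W x -> W y -> W (x + y).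
  by move=> Wx Wy; rewrite -[x]mul1r -(rmorph1 i); exact: WL.
(* otherwise W + K b is a larger subspace avoiding 1 *)
have dec b : exists a, W (b - i a).
  apply: contrapT => nb.
  have nWb : ~ W b by move=> Wb; apply: nb; exists 0; rewrite rmorph0 subr0.
  apply: (Wmax (fun x => exists w a, W w /\ x = w + i a * b)).
    split=> [x Wx|sub]; first by exists x, 0; rewrite rmorph0 mul0r addr0.
    by apply: nWb; apply: sub; exists 0, 1; rewrite rmorph1 mul1r add0r.
  split=> [[w [a [Ww E]]]|a x y [w [c [Ww ->]]] [w' [c' [Ww' ->]]]]; last first.
    exists (i a * w + w'), (a * c + c'); split; first exact: WL.
    by rewrite rmorphD rmorphM; ring.
  have [a0|a_n0] := eqVneq a 0.
    by apply: W1; rewrite E a0 rmorph0 mul0r addr0.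
  apply: nb; exists a^-1; suff -> : b - i a^-1 = i (- a^-1) * w by exact: WZ.
  have ia : i a^-1 * i a = 1 by rewrite -rmorphM mulVf ?rmorph1.
  by rewrite rmorphN -[X in X - _]mul1r -ia -[X in _ - X]mulr1 E; ring.
pose rho b := xget 0 [set a | W (b - i a)].
have rhoP b : W (b - i (rho b)).
  rewrite /rho; case: xgetP => [a -> //|nb].
  by have [a Wa] := dec b; case: (nb a).
have rhoE b a : W (b - i a) -> rho b = a.
  move=> Wb; apply/eqP; rewrite -subr_eq0; apply/contraT => d_n0; case: W1.
  have W2 : W (i (rho b - a)).
    have -> : i (rho b - a) = (b - i a) + i (-1) * (b - i (rho b)).
      by rewrite !rmorphB rmorphN rmorph1; ring.
    by apply: WD => //; exact: WZ.
  by rewrite -(rmorph1 i) -(mulVf d_n0) rmorphM; exact: WZ.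
exists rho; split=> [x y|a x|].
- apply: rhoE; rewrite rmorphD.
  have -> : x + y - (i (rho x) + i (rho y)) = (x - i (rho x)) + (y - i (rho y)).
    by ring.
  exact: WD.
- by apply: rhoE; rewrite rmorphM -mulrBr; exact: WZ.
- by apply: rhoE; rewrite rmorph1 subrr.
Qed.

Section Retractions.
Variables (A B : comNzRingType) (i : {rmorphism A -> B}).

Lemma retraction0 rho : retraction i rho -> rho 0 = 0.
Proof. by case=> D _ _; apply: (addrI (rho 0)); rewrite -D !addr0. Qed.

Lemma retraction_sum rho (I : Type) (r : seq I) (P : pred I) (F : I -> B) :
  retraction i rho ->
  rho (\sum_(j <- r | P j) F j) = \sum_(j <- r | P j) rho (F j).
Proof. by move=> R; have [D _ _] := R; exact: (big_morph rho D (retraction0 R)). Qed.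

(** Splittings descend along retractions, in particular from polynomials over an
    extension field to polynomials over the base field. *)
Lemma splits_retraction rho q (a : A) : retraction i rho ->
  splits q (i a) -> splits q a.
Proof.
move=> [D M R1] [psi [pD pM] E]; exists (fun x => rho (psi (i x))).
  by split=> [x y|b x]; rewrite ?rmorphD ?pD ?D // rmorphM rmorphXn pM M.
by rewrite E R1.
Qed.

Lemma retraction_poly rho : retraction i rho ->
  exists rho' : {poly B} -> {poly A}, retraction (map_poly i) rho'.
Proof.
move=> R; have [D M R1] := R.
exists (fun u => \poly_(j < size u) rho u`_j).
have cE u j : (\poly_(j < size u) rho u`_j)`_j = rho u`_j.
  by rewrite coef_poly; case: ltnP => // le_uj; rewrite nth_default ?(retraction0 R).
split=> [x y|a x|]; apply/polyP=> j.
- by rewrite coefD !cE coefD D.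
- rewrite cE !coefM (retraction_sum _ _ _ R).
  by apply: eq_bigr => l _; rewrite cE coef_map M.
- by rewrite cE !coef1; case: (j == 0%N) => //; exact: retraction0.
Qed.

Lemma retraction_mpoly n rho : retraction i rho ->
  exists rho' : {mpoly B[n]} -> {mpoly A[n]}, retraction (map_mpoly i) rho'.
Proof.
move=> R; have [D M R1] := R.
pose rho' (u : {mpoly B[n]}) : {mpoly A[n]} :=
  \sum_(m <- msupp u) rho u@_m *: 'X_[m].
exists rho'.
have cE u m : (rho' u)@_m = rho u@_m.
  rewrite raddf_sum /=; under eq_bigr => k _ do rewrite mcoeffZ mcoeffX.
  have [mu|nmu] := boolP (m \in msupp u).
    rewrite (bigD1_seq m) ?msupp_uniq //= eqxx mulr1 big1 ?addr0 // => k /negbTE ->.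
    by rewrite mulr0.
  rewrite (memN_msupp_eq0 nmu) (retraction0 R) big_seq big1 // => k ku.
  by case: eqP ku => [->|_ _]; rewrite ?(negbTE nmu) ?mulr0.
split=> [x y|a x|]; apply/mpolyP=> m.
- by rewrite mcoeffD !cE mcoeffD D.
- rewrite cE !mcoeffM (retraction_sum _ _ _ R).
  by apply: eq_bigr => l _; rewrite cE mcoeff_map_mpoly M.
- by rewrite cE !mcoeff1; case: (m == 0%MM) => //; exact: retraction0.
Qed.

End Retractions.

(** Frobenius is not surjective on an imperfect field; its one-sided inverse comes
    from [field_retraction]. *)
Lemma frob_retraction (K : fieldType) (p e : nat) : p \in [pchar K] ->
  splits (p ^ e) (1 : K).
Proof.
move=> charK; have [rho [rhoD rhoM rho1]] := field_retraction (pFrobenius_aut charK).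
have L1 : frob_linear p rho by split=> // a x; rewrite -rhoM pFrobenius_autE.
elim: e => [|e [psi L E]]; first by exists id.
exists (fun x => rho (psi x)); last by rewrite E.
by rewrite expnS; exact: frob_linear_comp.
Qed.

(** By the size bound, the coefficients of index [k + j q] with [j > 0] vanish,
    so that the lifted splitting only sees the [k]-th coefficient. *)
Lemma poly_splits_coef (A : comNzRingType) (p e k : nat) (c : {poly A}) :
  p \in [pchar A] -> (k < p ^ e)%N -> (size c <= k + p ^ e)%N ->
  splits (p ^ e) c`_k -> splits (p ^ e) c.
Proof.
move=> charA lt_kq sz [psi L E]; exists (lift_poly p e k psi).
  exact: lift_poly_frob_linear.
apply/polyP=> j; rewrite coef_lift_poly // coef1.
case: j => [|j]; first by rewrite mul0n addn0 E.
rewrite nth_default ?(frob_linear0 L) // (leq_trans sz) //.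
by rewrite leq_add2l leq_pmull.
Qed.

Lemma mpoly_rmorph_ext (n : nat) (A B : comNzRingType)
    (f g : {rmorphism {mpoly A[n]} -> B}) :
  (forall c, f c%:MP = g c%:MP) -> (forall i, f 'X_i = g 'X_i) -> f =1 g.
Proof.
move=> eqC eqX u; rewrite [u]mpolyE !rmorph_sum; apply: eq_bigr => m _ /=.
rewrite -mul_mpolyC !rmorphM eqC; congr (_ * _).
rewrite mpolyXE_id !rmorph_prod; apply: eq_bigr => i _.
by rewrite !rmorphXn eqX.
Qed.

Section Muni.
Variables (n : nat) (A : comNzRingType).

Definition uni_to_mpoly : {rmorphism {poly {mpoly A[n]}} -> {mpoly A[n.+1]}} :=
  horner_eval 'X_ord_max \o map_poly (@mwiden n A).

Lemma muniXm m : muni ('X_[m] : {mpoly A[n.+1]}) =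
  'X_[[multinom m (widen_ord (leqnSn n) i) | i < n]] *: 'X^(m ord_max).
Proof. by rewrite muniE msuppX big_seq1 mcoeffX eqxx scale1r. Qed.

Lemma uni_to_mpolyC c : uni_to_mpoly c%:P = mwiden c.
Proof. by rewrite /= /horner_eval map_polyC hornerC. Qed.

Lemma uni_to_mpolyX : uni_to_mpoly 'X = 'X_ord_max.
Proof. by rewrite /= /horner_eval map_polyX hornerX. Qed.

Lemma mnm1_widen (i : 'I_n) :
  [multinom U_(widen_ord (leqnSn n) i)%MM (widen_ord (leqnSn n) j) | j < n]
    = U_(i)%MM.
Proof. by apply/mnmP=> j; rewrite mnmE !mnm1E. Qed.

Lemma muniX_widen (i : 'I_n) :
  muni ('X_(widen_ord (leqnSn n) i) : {mpoly A[n.+1]}) = ('X_i)%:P.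
Proof.
rewrite muniXm mnm1_widen mnm1E.
by rewrite -val_eqE /= ltn_eqF // expr0 -mul_polyC mulr1.
Qed.

Lemma muniX_max : muni ('X_ord_max : {mpoly A[n.+1]}) = 'X.
Proof.
rewrite muniXm mnm1E eqxx expr1.
have -> : [multinom U_(ord_max)%MM (widen_ord (leqnSn n) j) | j < n] = 0%MM.
  apply/mnmP=> j; rewrite mnmE mnm1E mnm0E -val_eqE /= eq_sym.
  by rewrite ltn_eqF.
by rewrite mpolyX0 scale1r.
Qed.

Lemma muniK : cancel (@muni n A) uni_to_mpoly.
Proof.
move=> u; rewrite -[RHS]/(idfun u).
apply: (mpoly_rmorph_ext (f := uni_to_mpoly \o @muni n A)) => [c|i] /=.
  by rewrite muniC -[LHS]/(uni_to_mpoly _) uni_to_mpolyC mwidenC.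
rewrite -[LHS]/(uni_to_mpoly _).
have [[j ->]|->] : (exists j, i = widen_ord (leqnSn n) j) \/ i = ord_max.
  have [lt_in|le_ni] := ltnP i n; last first.
    by right; apply/val_inj/eqP; rewrite eqn_leq le_ni -ltnS ltn_ord.
  by left; exists (Ordinal lt_in); apply/val_inj.
  by rewrite muniX_widen uni_to_mpolyC mwidenX mnmwiden1.
by rewrite muniX_max uni_to_mpolyX.
Qed.

Lemma uni_to_mpolyK : cancel uni_to_mpoly (@muni n A).
Proof.
elim/poly_ind=> [|u c IH]; first by rewrite !rmorph0.
rewrite rmorphD muniD rmorphM muniM IH uni_to_mpolyX muniX_max uni_to_mpolyC.
congr (_ + _); rewrite -[LHS]/((@muni n A \o @mwiden n A) c).
rewrite -[RHS]/((polyC : {mpoly A[n]} -> _) c).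
apply: mpoly_rmorph_ext => [b|i] /=; first by rewrite mwidenC muniC.
by rewrite mwidenX mnmwiden1 muniX_widen.
Qed.

Lemma splits_muni q (c : {mpoly A[n.+1]}) : splits q (muni c) -> splits q c.
Proof. exact: (splits_iso (f := @muni n A) muniK). Qed.

Lemma coef_muni_msupp (u : {mpoly A[n.+1]}) j m : m \in msupp (muni u)`_j ->
  exists2 m', m' \in msupp u & m' ord_max = j
    /\ forall i, m' (widen_ord (leqnSn n) i) = m i.
Proof.
rewrite mcoeff_msupp => nz; apply: contrapT => nex; case/eqP: nz.
rewrite muniE coef_sum raddf_sum big_seq big1 //= => m' supp_m'.
rewrite coefZ coefXn; case: eqP => [jE|_]; last by rewrite mulr0 mcoeff0.
rewrite mulr1 mcoeffZ mcoeffX; case: eqP => [mE|_]; last by rewrite mulr0.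
by case: nex; exists m' => //; split=> // i; rewrite -mE mnmE.
Qed.

End Muni.

Lemma mpoly0E (A : comNzRingType) (u : {mpoly A[0]}) : u = (u@_0%MM)%:MP.
Proof.
apply/mpolyP=> m; have -> : m = 0%MM by apply/mnmP=> -[].
by rewrite mcoeffC eqxx mulr1.
Qed.

(** Strong F-regularity of the polynomial ring: split the leading coefficient with
    respect to the last variable, once [q] exceeds the degree. *)
Lemma mpoly_splits (K : fieldType) (p n : nat) (c : {mpoly K[n]}) :
  p \in [pchar K] -> c != 0 ->
  exists e0, forall e, (e0 <= e)%N -> splits (p ^ e) c.
Proof.
move=> charK; have p_gt1 := prime_gt1 (pcharf_prime charK).
elim: n c => [|n IH] c c_n0.
  exists 0%N => e _; have [sigma [sD sM] s1] := frob_retraction e charK.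
  exists (fun x => (sigma (x@_0%MM / c@_0%MM))%:MP).
    split=> [x y|a x]; first by rewrite mcoeffD mulrDl sD mpolyCD.
    rewrite [a]mpoly0E -rmorphXn mcoeffCM -mulrA sM mpolyCM.
    by congr (_ * _); rewrite -mpoly0E.
  rewrite divff ?s1 //; apply: contra_neq c_n0 => c0.
  by rewrite [c]mpoly0E c0 mpolyC0.
have nz : muni c != 0.
  by apply: contra_neq c_n0 => c0; rewrite -[c]muniK c0 rmorph0.
have [|e0 e0P] := IH (lead_coef (muni c)); first by rewrite lead_coef_eq0.
exists (maxn e0 (size (muni c))) => e; rewrite geq_max => /andP[le_e le_s].
have lt_sq : (size (muni c) < p ^ e)%N.
  by apply: leq_ltn_trans le_s _; rewrite ltn_expl.
apply: splits_muni; apply: (@poly_splits_coef _ _ _ (size (muni c)).-1).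
- exact: (rmorph_pchar (@mpolyC n K)).
- exact: leq_ltn_trans (leq_pred _) lt_sq.
- by rewrite (leq_trans (ltnW lt_sq)) // leq_addl.
exact: e0P.
Qed.

(** * Squarefree polynomials and disjoint sets of variables *)

Section Mixing.
Variable n : nat.
Implicit Types (A : pred 'I_n) (m k : 'X_{1..n}).

Definition mix A m k : 'X_{1..n} :=
  [multinom if A i then m i else k i | i < n].

Lemma mixE A m k i : mix A m k i = if A i then m i else k i.
Proof. by rewrite mnmE. Qed.

Lemma mixC A m k : mix (predC A) m k = mix A k m.
Proof. by apply/mnmP=> i; rewrite !mixE /=; case: (A i). Qed.

Lemma mix_id A m : mix A m m = m.
Proof. by apply/mnmP=> i; rewrite mixE if_same. Qed.

Lemma mix_mixl A m k l : mix A (mix A m k) l = mix A m l.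
Proof. by apply/mnmP=> i; rewrite !mixE; case: (A i). Qed.

Lemma mix_mixr A m k l : mix A m (mix A l k) = mix A m k.
Proof. by apply/mnmP=> i; rewrite !mixE; case: (A i). Qed.

Variable K : idomainType.
Implicit Types (u v f g h : {mpoly K[n]}).

Definition supported A u := forall m, m \in msupp u -> mix A m 0 = m.

Lemma supportedC A u m : supported (predC A) u -> m \in msupp u -> mix A 0 m = m.
Proof. by move=> sA mu; rewrite -mixC sA. Qed.

Lemma mcoeff_sum_msupp u m : \sum_(k <- msupp u) u@_k * (k == m)%:R = u@_m.
Proof.
rewrite [in RHS](mpolyE u) raddf_sum; apply: eq_bigr => k _ /=.
by rewrite mcoeffZ mcoeffX.
Qed.

(** A monomial is in a unique way the product of a monomial in the variables of [A]
    and one in the others, so the convolution sum has a single term. *)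
Lemma mcoeffM_supported A u v m : supported A u -> supported (predC A) v ->
  (u * v)@_m = u@_(mix A m 0) * v@_(mix A 0 m).
Proof.
move=> sAu sAv; rewrite mpolyME big_allpairs raddf_sum.
rewrite -[u@__]mcoeff_sum_msupp -[v@__]mcoeff_sum_msupp big_distrl big_seq.
rewrite [RHS]big_seq; apply: eq_bigr => k ku; rewrite raddf_sum big_distrr /=.
rewrite big_seq [RHS]big_seq; apply: eq_bigr => l lv.
rewrite mcoeffZ mcoeffX mulrACA -natrM mulnb; congr (_ * (nat_of_bool _)%:R).
have kE := sAu k ku; have lE := supportedC sAv lv.
apply/eqP/andP=> [<-|[/eqP kE' /eqP lE']].
  split; apply/eqP/mnmP=> i.
    rewrite -{1}kE !mixE mnmDE; case: ifP => // Ai.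
    by rewrite -lE mixE Ai mnm0E addn0.
  rewrite -{1}lE !mixE mnmDE; case: ifP => // Ai.
  by rewrite -kE mixE Ai mnm0E add0n.
apply/mnmP=> i; rewrite mnmDE kE' lE' !mixE; case: ifP => _; rewrite mnm0E //.
by rewrite addn0.
Qed.

(** If [f = u * v] with [u] in the variables of [A] and [v] in the others, this
    recovers [u], up to the scalar given by the coefficient of [v] at the second
    half of [m0]. *)
Definition part A m0 f : {mpoly K[n]} :=
  \sum_(m <- msupp f | mix A 0 m == mix A 0 m0) f@_m *: 'X_[mix A m 0].

Lemma mcoeff_part A m0 f k :
  (part A m0 f)@_k = if mix A k 0 == k then f@_(mix A k m0) else 0.
Proof.
rewrite raddf_sum /=; case: eqP => [kE|nkE]; last first.
  rewrite big1 // => m _; rewrite mcoeffZ mcoeffX; case: eqP => [mE|_].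
    by case: nkE; rewrite -mE mix_mixl.
  by rewrite mulr0.
rewrite -mcoeff_sum_msupp big_mkcond; apply: eq_bigr => m _ /=.
have -> : (m == mix A k m0) = (mix A 0 m == mix A 0 m0) && (mix A m 0 == k).
  apply/eqP/andP=> [->|[/eqP E1 /eqP E2]]; first by rewrite mix_mixr mix_mixl kE.
  apply/mnmP=> i; move/mnmP/(_ i): E1; move/mnmP/(_ i): E2.
  by rewrite !mixE; case: (A i) => [->|_ ->].
by rewrite mcoeffZ mcoeffX; case: eqP => //= _; rewrite mulr0.
Qed.

Lemma supported_part A m0 f : supported A (part A m0 f).
Proof.
move=> k; rewrite mcoeff_msupp mcoeff_part.
by case: (mix A k 0 =P k); rewrite ?eqxx.
Qed.

Lemma unit_coef u m : u \is a GRing.unit -> m != 0%MM -> u@_m = 0.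
Proof. by move=> /andP[/eqP -> _] /negbTE nz; rewrite mcoeffC nz mulr0. Qed.

(** A nonconstant factor [u] leaves a trace in the product: some monomial of
    [u * v] involves the variables of [A]. *)
Lemma nonunit_coef A u v : supported A u -> supported (predC A) v ->
  ~ u = (u@_0%MM)%:MP -> v != 0 ->
  exists2 m, (u * v)@_m != 0 & mix A m 0 != 0%MM.
Proof.
move=> sAu sAv u_nc v_n0.
have [k ku k_n0] : exists2 k, k \in msupp u & k != 0%MM.
  apply: contrapT => nex; apply: u_nc; apply/mpolyP=> k; rewrite mcoeffC.
  case: eqP => [->|/eqP k_n0]; rewrite ?mulr1 ?mulr0 //.
  by apply: memN_msupp_eq0; apply/negP=> ku; apply: nex; exists k.
have lv : mlead v \in msupp v by rewrite mlead_supp.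
have kE := sAu k ku; have lE := supportedC sAv lv.
exists (mix A k (mlead v)); last by rewrite mix_mixl kE.
rewrite (mcoeffM_supported _ sAu sAv) mix_mixl mix_mixr kE lE.
by rewrite mulf_neq0 // -mcoeff_msupp.
Qed.

End Mixing.

Section DegreeInOneVariable.
Variables (n : nat) (K : fieldType) (i : 'I_n).
Implicit Types (u v : {mpoly K[n]}).

(** Multiplying the [i]-th variable by ['X] turns its degree into the degree of a
    univariate polynomial over a domain, which is additive on products. *)
Definition grade_var : {rmorphism {mpoly K[n]} -> {poly {mpoly K[n]}}} :=
  mmap (polyC \o @mpolyC n K)
       (fun j => if j == i then ('X_j)%:P * 'X else ('X_j)%:P).

Lemma grade_varX m : grade_var 'X_[m] = ('X_[m])%:P * 'X^(m i).
Proof.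
rewrite /= mmapX /mmap1 [in RHS]mpolyXE_id rmorph_prod /=.
rewrite (bigD1 i) //= [in RHS](bigD1 i) //= eqxx exprMn rmorphXn /= -!mulrA.
congr (_ * _); rewrite mulrC; congr (_ * _); apply: eq_bigr => j /negbTE ->.
by rewrite rmorphXn.
Qed.

Lemma coef_grade_var u d m : (grade_var u)`_d@_m = u@_m *+ (m i == d).
Proof.
rewrite {1}[u]mpolyE rmorph_sum coef_sum raddf_sum /=.
rewrite -[u@_m in RHS]mcoeff_sum_msupp -sumrMnl; apply: eq_bigr => k _.
rewrite -mul_mpolyC rmorphM /= -[mmap _ _ 'X_[k]]/(grade_var _) grade_varX mmapC /=.
rewrite mulrA -rmorphM /= coefCM coefXn mul_mpolyC -scalerAl mcoeffZ.
rewrite [in LHS]mulr_natr mcoeffMn mcoeffX -mulrnAr eq_sym [d == _]eq_sym.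
by case: (eqVneq m k) => [->|_]; rewrite ?mulr0 ?mul0rn ?mulr0.
Qed.

Lemma grade_var_size u m : m \in msupp u -> (m i < size (grade_var u))%N.
Proof.
rewrite mcoeff_msupp => nz; rewrite ltnNge; apply/negP=> le_s.
have := coef_grade_var u (m i) m; rewrite nth_default // eqxx mcoeff0.
by move/esym/eqP; rewrite (negbTE nz).
Qed.

Lemma grade_var_sqf u : squarefree_supported u -> (size (grade_var u) <= 2)%N.
Proof.
move=> sqf; apply/leq_sizeP=> d le2d; apply/mpolyP=> m.
rewrite coef_grade_var mcoeff0; case: eqP => // md.
have [mu|/memN_msupp_eq0 ->//] := boolP (m \in msupp u).
by have := sqf m mu i; rewrite md leqNgt le2d.
Qed.

Lemma grade_var_sqf_mul u v : squarefree_supported (u * v) -> u * v != 0 ->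
  (size (grade_var u) + size (grade_var v) <= 3)%N.
Proof.
move=> sqf; rewrite mulf_eq0 => /norP[u0 v0].
have nz (w : {mpoly K[n]}) : w != 0 -> grade_var w != 0.
  move=> w0; rewrite -size_poly_gt0.
  by apply: leq_ltn_trans (grade_var_size (mlead_supp w0)).
have := grade_var_sqf sqf; rewrite rmorphM size_mul ?nz //.
by case: (_ + _)%N.
Qed.

End DegreeInOneVariable.

Section SquarefreeFactors.
Variables (n : nat) (K : fieldType).
Implicit Types (u v f g h : {mpoly K[n]}).

Lemma sqf_factor u v : squarefree_supported (u * v) -> u * v != 0 ->
  squarefree_supported u.
Proof.
move=> sqf nz m mu i; have := grade_var_sqf_mul i sqf nz.
have v0 : v != 0 by apply: contra_neq nz => ->; rewrite mulr0.
move: (grade_var_size i mu) (grade_var_size i (mlead_supp v0)).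
by move=> a b c; rewrite -ltnS -ltnS -addn2 -addn1; lia.
Qed.

(** Degrees in each variable add up, so a variable occurring in both factors would
    have degree at least two in the product. *)
Lemma sqf_factor_supported u v :
  squarefree_supported (u * v) -> u * v != 0 ->
  exists2 A, supported A u & supported (predC A) v.
Proof.
move=> sqf nz; pose A i := has (fun m : 'X_{1..n} => m i != 0%N) (msupp u).
exists A => m mw; apply/mnmP=> i; rewrite mixE mnm0E /=.
  by case: ifPn => // /hasPn/(_ m mw); rewrite negbK => /eqP.
case: ifPn => //; rewrite negbK => /hasP[k ku k0].
have := grade_var_sqf_mul i sqf nz.
move: (grade_var_size i mw) (grade_var_size i ku) k0; lia.
Qed.

End SquarefreeFactors.

(** * Coefficient matrices of rank one *)

Lemma mpoly_unitP (n : nat) (K : fieldType) (u : {mpoly K[n]}) :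
  u \is a GRing.unit <-> u != 0 /\ u = (u@_0%MM)%:MP.
Proof.
split=> [uU|[u0 uE]].
  by split; [apply: contraTneq uU => ->; rewrite unitr0|case/andP: uU => /eqP].
apply/andP; split; first exact/eqP.
by rewrite unitfE; apply: contra_neq u0 => c0; rewrite uE c0 mpolyC0.
Qed.

Section RankOne.
Variables (n : nat) (K : fieldType).
Implicit Types (A : pred 'I_n) (u v f g h : {mpoly K[n]}).

(** The 2 x 2 minors of the matrix of coefficients of [u * v], with rows indexed by
    the monomials in the variables of [A] and columns by those in the others. *)
Lemma mulmpoly_exchange A u v m m' :
  supported A u -> supported (predC A) v ->
  (u * v)@_m * (u * v)@_m' = (u * v)@_(mix A m m') * (u * v)@_(mix A m' m).
Proof.
move=> sAu sAv; rewrite !(mcoeffM_supported _ sAu sAv) !mix_mixl !mix_mixr.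
ring.
Qed.

Lemma mcoeff_part_mul A m0 f g m :
  (part A m0 f * part (predC A) m0 g)@_m = f@_(mix A m m0) * g@_(mix A m0 m).
Proof.
rewrite (mcoeffM_supported _ (@supported_part _ _ _ _ _) (@supported_part _ _ _ _ _)).
by rewrite !mcoeff_part !mixC !mix_mixl !mix_mixr !eqxx.
Qed.

Lemma supportedZ A c u : supported A u -> supported A (c *: u).
Proof. by move=> sAu m mu; apply: sAu; apply: (msuppZ_le mu). Qed.

Lemma supported_predCC A u : supported A u -> supported (predC (predC A)) u.
Proof. by move=> sAu m mu; rewrite !mixC sAu. Qed.

Lemma nonunit_nonconst u : u != 0 -> u \isn't a GRing.unit ->
  ~ u = (u@_0%MM)%:MP.
Proof. by move=> u0 /negP uU uE; apply: uU; apply/mpoly_unitP. Qed.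

(** A rank one matrix is recovered from the row and the column through a nonzero
    entry. *)
Lemma exchange_factor A m0 f : f@_m0 != 0 ->
  (forall m, f@_m * f@_m0 = f@_(mix A m m0) * f@_(mix A m0 m)) ->
  f = ((f@_m0)^-1 *: part A m0 f) * part (predC A) m0 f.
Proof.
move=> nz ex; apply/mpolyP=> m.
by rewrite -scalerAl mcoeffZ mcoeff_part_mul -ex mulrCA mulVf ?mulr1.
Qed.

(** The last hypothesis says that the column of [t g + h] through [m0] is a constant
    multiple of its entry at [m0]. That constant vector is the factor [u], and
    the row through [m0] supplies the linear forms [t v + w]. *)
Lemma pencil_factor A m0 g h : g@_m0 != 0 ->
  (forall m, g@_m * g@_m0 = g@_(mix A m m0) * g@_(mix A m0 m)) ->
  (forall m, g@_m * h@_m0 + h@_m * g@_m0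
           = g@_(mix A m m0) * h@_(mix A m0 m) + h@_(mix A m m0) * g@_(mix A m0 m)) ->
  (forall m, g@_m0 * h@_(mix A m m0) = h@_m0 * g@_(mix A m m0)) ->
  exists u v w, [/\ supported A u, supported (predC A) v, supported (predC A) w,
    g = u * v & h = u * w].
Proof.
move=> nz ex1 ex2 root0.
exists ((g@_m0)^-1 *: part A m0 g), (part (predC A) m0 g), (part (predC A) m0 h).
split; try exact: supported_part; first exact/supportedZ/supported_part.
  exact: exchange_factor.
apply/mpolyP=> m; rewrite -scalerAl mcoeffZ mcoeff_part_mul.
apply: (mulfI (mulf_neq0 nz nz)); rewrite -[RHS]mulrA mulVKf //.
have /(congr1 (fun x => g@_m0 * x)) := ex2 m.
have /(congr1 (fun x => h@_m0 * x)) := ex1 m.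
have /(congr1 (fun x => x * g@_(mix A m0 m))) := root0 m.
move=> E0 E1 E2.
have -> : g@_m0 * g@_m0 * h@_m =
  g@_m0 * (g@_m * h@_m0 + h@_m * g@_m0) - h@_m0 * (g@_m * g@_m0) by ring.
by rewrite E2 E1 mulrDr [g@_m0 * (h@_ _ * _)]mulrA E0; ring.
Qed.

(** The three hypotheses are the coefficients, in [t], of the vanishing of the minors
    through [m0] of the matrix of [t g + h]. At the root [t = - h_m0 / g_m0] of
    the entry at [m0], every product of an entry of its column by an entry of
    its row vanishes; so the whole column or the whole row vanishes there, and
    is a constant multiple of that entry. *)
Lemma pencil_rank_one A m0 g h : g@_m0 != 0 ->
  (forall m, g@_m * g@_m0 = g@_(mix A m m0) * g@_(mix A m0 m)) ->
  (forall m, g@_m * h@_m0 + h@_m * g@_m0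
           = g@_(mix A m m0) * h@_(mix A m0 m) + h@_(mix A m m0) * g@_(mix A m0 m)) ->
  (forall m, h@_m * h@_m0 = h@_(mix A m m0) * h@_(mix A m0 m)) ->
  exists B, (B = A \/ B = predC A) /\
  exists u v w, [/\ supported B u, supported (predC B) v, supported (predC B) w,
    g = u * v & h = u * w].
Proof.
move=> nz ex1 ex2 ex3.
(* g_m0 times the value of t g_m + h_m at t = - h_m0 / g_m0 *)
pose d m := g@_m0 * h@_m - h@_m0 * g@_m.
have dd m : d (mix A m m0) * d (mix A m0 m) = 0.
  transitivity (g@_m0 ^+ 2 * (h@_(mix A m m0) * h@_(mix A m0 m))
    - g@_m0 * h@_m0 * (g@_(mix A m m0) * h@_(mix A m0 m)
         + h@_(mix A m m0) * g@_(mix A m0 m))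
    + h@_m0 ^+ 2 * (g@_(mix A m m0) * g@_(mix A m0 m))); first by rewrite /d; ring.
  by rewrite -ex1 -ex2 -ex3; ring.
have [d0|] := pselect (forall m, d (mix A m m0) = 0).
  exists A; split; first by left.
  apply: (pencil_factor nz) => // m.
  by apply/eqP; rewrite -subr_eq0; apply/eqP/d0.
move=> /asboolPn/asboolP/existsNP[m1 /eqP d1]; exists (predC A); split; first by right.
apply: (pencil_factor nz) => m; rewrite !mixC.
- by rewrite ex1 mulrC.
- by rewrite ex2 addrC; congr (_ + _); rewrite mulrC.
apply/eqP; rewrite -subr_eq0.
have /eqP := dd (mix A m1 m).
by rewrite mix_mixl mix_mixr mulf_eq0 (negbTE d1).
Qed.

End RankOne.

(** A factorization over [L] makes the matrix of coefficients of [f] have rank one;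
    its entries are in [K], so [exchange_factor] factors [f] over [K] along the
    same partition of the variables. *)
Lemma map_mpoly_irreducible (n : nat) (K L : fieldType) (i : {rmorphism K -> L})
    (f : {mpoly K[n]}) :
  is_irreducible f -> squarefree_supported f -> is_irreducible (map_mpoly i f).
Proof.
move=> [f0 fU firr] sqf.
have i_eq0 a : (i a == 0) = (a == 0) by exact: fmorph_eq0.
have F0 : map_mpoly i f != 0.
  apply: contra_neq f0 => F0; apply/mpolyP=> m; apply: (fmorph_inj i).
  by rewrite -mcoeff_map_mpoly F0 !mcoeff0 rmorph0.
have sqF : squarefree_supported (map_mpoly i f).
  move=> m; rewrite mcoeff_msupp mcoeff_map_mpoly i_eq0 -mcoeff_msupp.
  exact: sqf.
split=> //.
  apply: contra fU => /mpoly_unitP[_ FE]; apply/mpoly_unitP; split=> //.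
  apply/mpolyP=> m; apply: (fmorph_inj i); rewrite -mcoeff_map_mpoly FE.
  by rewrite mcoeff_map_mpoly !mcoeffC rmorphM rmorph_nat.
move=> u v FE; apply: contrapT => /not_orP[/negP uU /negP vU].
rewrite FE in F0 sqF.
have [A sAu sAv] := sqf_factor_supported sqF F0.
have f_m0 : f@_(mlead f) != 0 by rewrite mleadc_eq0.
have fE : f = ((f@_(mlead f))^-1 *: part A (mlead f) f) * part (predC A) (mlead f) f.
  apply: exchange_factor => // m; apply: (fmorph_inj i).
  by rewrite !rmorphM -!mcoeff_map_mpoly FE; apply: mulmpoly_exchange.
have [u0 v0] : u != 0 /\ v != 0.
  by apply/andP; rewrite -negb_or -mulf_eq0.
have sP B := @supported_part n K B (mlead f) f.
have coef_n0 m : (u * v)@_m != 0 -> f@_m != 0.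
  by rewrite -FE mcoeff_map_mpoly i_eq0.
have [U|U] := firr _ _ fE.
  have [m /coef_n0] := nonunit_coef sAu sAv (nonunit_nonconst u0 uU) v0.
  rewrite {1}fE (mcoeffM_supported _ (supportedZ (sP A)) (sP _)) => fm0 mn0.
  by move: fm0; rewrite (unit_coef U mn0) mul0r eqxx.
have [m] := nonunit_coef sAv (supported_predCC sAu) (nonunit_nonconst v0 vU) u0.
rewrite mulrC => /coef_n0.
rewrite {1}fE mulrC (mcoeffM_supported _ (sP _) (supported_predCC (supportedZ (sP A)))) => fm0 mn0.
by move: fm0; rewrite (unit_coef U mn0) mul0r eqxx.
Qed.

(** * The pencil obtained by freezing one variable *)

Section PolynomialUnits.
Variable A : idomainType.

Lemma linear_poly_unit (c d : A) : c != 0 ->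
  (d%:P + c%:P * 'X : {poly A}) \isn't a GRing.unit.
Proof.
move=> c0; apply/negP; rewrite poly_unitE => /andP[/eqP sz _].
have := nth_default 0 (eq_leq sz).
rewrite coefD coefC coefCM coefX mulr1 add0r => /eqP.
by rewrite (negbTE c0).
Qed.

Lemma polyC_unit (c : A) :
  (c%:P : {poly A}) \is a GRing.unit -> c \is a GRing.unit.
Proof. by rewrite poly_unitE coefC => /andP[]. Qed.

End PolynomialUnits.

(** A minor of a matrix of linear forms in [t] whose coefficients come from [K]. *)
Lemma quadratic_expand (K M : fieldType) (i : {rmorphism K -> M}) (t : M)
    (a1 a2 b1 b2 c1 c2 d1 d2 : K) :
  (t * i a1 + i a2) * (t * i b1 + i b2) = (t * i c1 + i c2) * (t * i d1 + i d2) ->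
  i (a1 * b1 - c1 * d1) * t ^+ 2
    + i (a1 * b2 + a2 * b1 - (c1 * d2 + c2 * d1)) * t + i (a2 * b2 - c2 * d2) = 0.
Proof.
rewrite !(rmorphB, rmorphD, rmorphM) /= => /eqP; rewrite -subr_eq0 => /eqP E.
by rewrite -[RHS]E; ring.
Qed.

Section Pencil.
Variables (n : nat) (K M : fieldType) (i : {rmorphism K -> M}) (t : M).
Hypothesis t_free : forall a b c,
  i a * t ^+ 2 + i b * t + i c = 0 -> [/\ a = 0, b = 0 & c = 0].
Variables (g h : {mpoly K[n]}).
Hypotheses (sqg : squarefree_supported g) (sqh : squarefree_supported h).
Hypothesis irr_gh : is_irreducible (h%:P + g%:P * 'X : {poly {mpoly K[n]}}).
Hypothesis g0 : g != 0.

Definition pencil : {mpoly M[n]} := map_mpoly i h + t *: map_mpoly i g.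

Lemma mcoeff_pencil m : pencil@_m = t * i g@_m + i h@_m.
Proof. by rewrite mcoeffD mcoeffZ !mcoeff_map_mpoly addrC. Qed.

Lemma mcoeff_pencil_eq0 m : pencil@_m = 0 -> g@_m = 0 /\ h@_m = 0.
Proof.
move=> E; have [] := t_free (a := 0) (b := g@_m) (c := h@_m) => //.
by rewrite rmorph0 mul0r add0r mulrC -mcoeff_pencil.
Qed.

Lemma pencil_sqf : squarefree_supported pencil.
Proof.
move=> m; rewrite mcoeff_msupp => nz.
have [gm|/memN_msupp_eq0 gm] := boolP (m \in msupp g); first exact: sqg.
have [hm|/memN_msupp_eq0 hm] := boolP (m \in msupp h); first exact: sqh.
by rewrite mcoeff_pencil gm hm rmorph0 mulr0 addr0 eqxx in nz.
Qed.

Lemma pencil_neq0 : pencil != 0.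
Proof.
apply: contra_neq g0 => F0; apply/mpolyP=> m; rewrite mcoeff0.
by case: (@mcoeff_pencil_eq0 m) => //; rewrite F0 mcoeff0.
Qed.

(** By freeness of [t], a factorization of the pencil is a rank one condition on
    linear forms over [K]; then [pencil_rank_one] produces a common factor [U] of
    [g] and [h] over [K]. Its cofactor in [h + g X] has positive degree in [X], so
    [U] is constant, although it carries one of the two sets of variables of
    the factorization. *)
Lemma pencil_no_factor u v A : pencil = u * v -> supported A u ->
  supported (predC A) v -> u != 0 -> v != 0 ->
  u \isn't a GRing.unit -> v \isn't a GRing.unit -> False.
Proof.
move=> FE sAu sAv u0 v0 uU vU.
pose m0 := mlead g; have gm0 : g@_m0 != 0 by rewrite mleadc_eq0.
have ex m : [/\ g@_m * g@_m0 = g@_(mix A m m0) * g@_(mix A m0 m),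
   g@_m * h@_m0 + h@_m * g@_m0
           = g@_(mix A m m0) * h@_(mix A m0 m) + h@_(mix A m m0) * g@_(mix A m0 m)
   & h@_m * h@_m0 = h@_(mix A m m0) * h@_(mix A m0 m)].
  have := mulmpoly_exchange m m0 sAu sAv; rewrite -FE !mcoeff_pencil => E.
  have [|/eqP + /eqP + /eqP] := t_free
    (a := g@_m * g@_m0 - g@_(mix A m m0) * g@_(mix A m0 m))
    (b := g@_m * h@_m0 + h@_m * g@_m0 -
       (g@_(mix A m m0) * h@_(mix A m0 m) + h@_(mix A m m0) * g@_(mix A m0 m)))
    (c := h@_m * h@_m0 - h@_(mix A m m0) * h@_(mix A m0 m)).
    exact: (quadratic_expand E).
  by rewrite !subr_eq0 => /eqP -> /eqP -> /eqP ->.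
have [B [BA [U [V1 [V0 [sU sV1 sV0 gE hE]]]]]] := pencil_rank_one gm0
  (fun m => let: And3 e _ _ := ex m in e) (fun m => let: And3 _ e _ := ex m in e)
  (fun m => let: And3 _ _ e := ex m in e).
have [w [z [sw sz w0 wU [z0 wzE]]]] : exists w z, [/\ supported B w,
    supported (predC B) z, w != 0, w \isn't a GRing.unit & z != 0 /\ pencil = w * z].
  case: BA => ->; first by exists u, v; split.
  exists v, u; split=> //; first exact: supported_predCC.
  by rewrite mulrC.
have [m + mn0] := nonunit_coef sw sz (nonunit_nonconst w0 wU) z0.
case: irr_gh => _ _ /(_ U%:P (V0%:P + V1%:P * 'X)).
rewrite mulrDr mulrA -!rmorphM /= -gE -hE => /(_ erefl) [/polyC_unit UU|]; last first.
  have V10 : V1 != 0 by apply: contra_neq g0 => V10; rewrite gE V10 mulr0.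
  by move=> WU; have := linear_poly_unit V0 V10; rewrite WU.
rewrite -wzE mcoeff_pencil gE hE !(mcoeffM_supported _ sU) //.
by rewrite (unit_coef UU mn0) !mul0r !rmorph0 mulr0 addr0 eqxx.
Qed.

Lemma pencil_irreducible : pencil \isn't a GRing.unit -> is_irreducible pencil.
Proof.
move=> FU; split=> //; first exact: pencil_neq0.
move=> u v FE; apply: contrapT => /not_orP[/negP uU /negP vU].
have := pencil_neq0; have := pencil_sqf; rewrite FE => sq nz.
have [A sAu sAv] := sqf_factor_supported sq nz.
move: nz; rewrite mulf_eq0 => /norP[u0 v0].
exact: (pencil_no_factor FE sAu sAv).
Qed.

(** If the cofactor is not constant, [g] has a monomial with variables that do not
    occur in the pencil, which is absurd since the monomials of [g] survive in
    [t g + h]. If it is constant, then [g] and [h] are proportional, so [g] divides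
    [h + g X] and has to be constant, and the pencil would be a unit. *)
Lemma pencil_ndvd w : pencil \isn't a GRing.unit -> map_mpoly i g <> w * pencil.
Proof.
move=> FU gE.
have sqG : squarefree_supported (w * pencil).
  move=> m; rewrite -gE mcoeff_msupp mcoeff_map_mpoly fmorph_eq0 -mcoeff_msupp.
  exact: sqg.
have G0 : w * pencil != 0.
  rewrite -gE; apply: contra_neq g0 => G0; apply/mpolyP=> m; apply: (fmorph_inj i).
  by rewrite -mcoeff_map_mpoly G0 !mcoeff0 rmorph0.
have [A sAw sAF] := sqf_factor_supported sqG G0.
have [w0 F0] : w != 0 /\ pencil != 0 by apply/andP; rewrite -negb_or -mulf_eq0.
have [/mpoly_unitP[_ wE]|wU] := boolP (w \is a GRing.unit); last first.
  have [m] := nonunit_coef sAw sAF (nonunit_nonconst w0 wU) F0.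
  rewrite -gE mcoeff_map_mpoly fmorph_eq0 => gm0 /eqP; case.
  have mF : m \in msupp pencil.
    by rewrite mcoeff_msupp; apply: contra_neq gm0 => /mcoeff_pencil_eq0[].
  by rewrite -(supportedC sAF mF) mix_mixl mix_id.
pose m0 := mlead g; have gm0 : g@_m0 != 0 by rewrite mleadc_eq0.
have coefE m : i g@_m = w@_0%MM * (t * i g@_m + i h@_m).
  by rewrite -mcoeff_pencil -mcoeffCM -wE -gE mcoeff_map_mpoly.
have prop m : g@_m * h@_m0 = g@_m0 * h@_m.
  apply: (fmorph_inj i); rewrite !rmorphM.
  have w00 : w@_0%MM != 0 by apply: contra_neq w0 => w00; rewrite wE w00 mpolyC0.
  apply: (mulfI w00).
  have E : i g@_m * (w@_0%MM * (t * i g@_m0 + i h@_m0)) =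
           i g@_m0 * (w@_0%MM * (t * i g@_m + i h@_m)) by rewrite -!coefE mulrC.
  apply/eqP; rewrite -subr_eq0; apply/eqP; move/eqP: E; rewrite -subr_eq0 => /eqP E.
  by rewrite -[RHS]E; ring.
have hE : h = (h@_m0 / g@_m0) *: g.
  apply/mpolyP=> m; rewrite mcoeffZ mulrAC [_ * g@_m]mulrC prop.
  by rewrite mulrAC divff // mul1r.
case: irr_gh => _ _ /(_ g%:P (((h@_m0 / g@_m0)%:MP)%:P + 1%:P * 'X)).
rewrite mulrDr mulrA -!rmorphM /= mulr1 [g * _]mulrC mul_mpolyC -hE.
case=> // [/polyC_unit/mpoly_unitP[_ gC]|]; last exact/negP/linear_poly_unit/oner_neq0.
move/negP: FU; apply; apply/mpoly_unitP; split=> //.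
have gm m : g@_m = g@_0%MM * (m == 0%MM)%:R by rewrite {1}gC mcoeffC.
apply/mpolyP=> m; rewrite mcoeffC !mcoeff_pencil hE !mcoeffZ gm.
by case: eqP; rewrite ?mulr1 // !mulr0 !rmorph0 mulr0 addr0.
Qed.

End Pencil.

(** * Irreducible squarefree polynomials are prime *)

Definition divides (A : comNzRingType) (a b : A) : Prop := exists c, b = c * a.

Definition prime_elt (A : comNzRingType) (a : A) : Prop :=
  forall b c, divides a (b * c) -> divides a b \/ divides a c.

Section Divides.
Variable A : comNzRingType.
Implicit Types a b c : A.

Lemma divides0 a : divides a 0.
Proof. by exists 0; rewrite mul0r. Qed.

Lemma dividesD a b c : divides a b -> divides a c -> divides a (b + c).
Proof. by move=> [x ->] [y ->]; exists (x + y); rewrite mulrDl. Qed.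

Lemma dividesB a b c : divides a b -> divides a c -> divides a (b - c).
Proof. by move=> [x ->] [y ->]; exists (x - y); rewrite mulrBl. Qed.

Lemma divides_mull a b c : divides a c -> divides a (b * c).
Proof. by move=> [x ->]; exists (b * x); rewrite mulrA. Qed.

Lemma divides_mulr a b c : divides a b -> divides a (b * c).
Proof. by rewrite mulrC; exact: divides_mull. Qed.

Lemma divides_sum (I : Type) (r : seq I) (P : pred I) (F : I -> A) a :
  (forall i, P i -> divides a (F i)) -> divides a (\sum_(i <- r | P i) F i).
Proof. by move=> aF; elim/big_ind: _ => //; [exact: divides0|exact: dividesD]. Qed.

End Divides.

Lemma muni_divides (A : comNzRingType) n (a b : {mpoly A[n.+1]}) :
  divides (muni a) (muni b) -> divides a b.
Proof.
move=> [w E]; exists (uni_to_mpoly n A w).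
by rewrite -[b]muniK E rmorphM muniK.
Qed.

Section PolyDivides.
Variable A : comNzRingType.

Lemma polyC_divides (a : A) (u : {poly A}) :
  divides a%:P u <-> forall j, divides a u`_j.
Proof.
split=> [[w ->] j|a_u]; first by exists w`_j; rewrite coefMC.
have [w wE] := choice a_u; exists (\poly_(j < size u) w j).
apply/polyP=> j; rewrite coefMC coef_poly; case: ltnP => [_|le_uj]; first exact: wE.
by rewrite mul0r nth_default.
Qed.

Lemma polyC_ndivides (a : A) (u : {poly A}) : ~ divides a%:P u ->
  exists2 j, ~ divides a u`_j & forall l, (l < j)%N -> divides a u`_l.
Proof.
move=> /polyC_divides/asboolPn/asboolP/existsNP [j0 nj0].
have ex : exists j, ~~ `[< divides a u`_j >] by exists j0; apply/asboolPn.
exists (ex_minn ex); case: ex_minnP => j /asboolPn // _ minj l lt_lj.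
by apply: contrapT => /asboolPn/minj; rewrite leqNgt lt_lj.
Qed.

(** Gauss's lemma: look at the first coefficients of [u] and of [v] that [a] does not
    divide. *)
Lemma polyC_prime (a : A) : prime_elt a -> prime_elt a%:P.
Proof.
move=> pa u v a_uv; apply: contrapT => /not_orP[].
move=> /polyC_ndivides[j ju lt_j] /polyC_ndivides[k kv lt_k].
suff : divides a (u`_j * v`_k) by case/pa.
have /polyC_divides/(_ (j + k)%N) := a_uv; rewrite coefM.
have lt_jk : (j < (j + k).+1)%N by rewrite ltnS leq_addr.
rewrite (bigD1 (Ordinal lt_jk)) //= addKn => a_sum.
suff a_rest : divides a (\sum_(l < (j + k).+1 | l != Ordinal lt_jk) u`_l * v`_(j + k - l)).
  by have := dividesB a_sum a_rest; rewrite addrK.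
apply: divides_sum => l; rewrite -val_eqE /= neq_ltn => /orP[lt_lj|lt_jl].
  exact/divides_mulr/lt_j.
apply/divides_mull/lt_k; have := ltn_ord l; lia.
Qed.

Lemma pseudo_division (g h : A) (u : {poly A}) : exists N r b,
  (g ^+ N)%:P * u = r%:P + b * (h%:P + g%:P * 'X).
Proof.
elim/poly_ind: u => [|u c [N [r [b E]]]].
  by exists 0%N, 0, 0; rewrite mulr0 mul0r addr0.
exists N.+1, (g ^+ N.+1 * c - r * h), (g%:P * b * 'X + r%:P).
rewrite exprS mulrDr polyCM -2![in LHS]mulrA [_ * (u * _)]mulrA E.
by rewrite rmorphB !rmorphM /=; ring.
Qed.

End PolyDivides.

Section LinearPrime.
Variable A : idomainType.
Variables g h : A.
Local Notation f := (h%:P + g%:P * 'X : {poly A}).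
Hypothesis g0 : g != 0.
Hypothesis g_regular : forall c, divides f (g%:P * c) -> divides f c.

Lemma size_linear : size f = 2.
Proof. by rewrite addrC size_MXaddC polyC_eq0 (negbTE g0) size_polyC g0. Qed.

Lemma linear_ndivides (r : A) : divides f r%:P -> r = 0.
Proof.
case=> w E; apply/eqP/contraT => r0.
have w0 : w != 0.
  by apply: contra_neq r0 => w0; apply/eqP; rewrite -polyC_eq0 E w0 mul0r.
have f0 : f != 0 by rewrite -size_poly_gt0 size_linear.
have := congr1 (fun u : {poly A} => size u) E.
rewrite size_mul // size_polyC r0 size_linear.
by rewrite -size_poly_gt0 in w0; case: (size w) w0 => // s _; rewrite !addnS.
Qed.

Lemma g_regularX N c : divides f ((g ^+ N)%:P * c) -> divides f c.
Proof.
elim: N => [|N IH]; first by rewrite expr0 mul1r.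
by rewrite exprS polyCM -mulrA => /g_regular.
Qed.

(** Modulo [f], and up to powers of the regular element [g], every polynomial is
    congruent to a constant; and [f] divides no nonzero constant. *)
Lemma linear_prime : prime_elt f.
Proof.
move=> u v f_uv.
have [N [r [b rE]]] := pseudo_division g h u.
have [M [s [d sE]]] := pseudo_division g h v.
have fm w : divides f (w * f) by exists w.
have /linear_ndivides/eqP : divides f (r * s)%:P.
  have -> : (r * s)%:P = (g ^+ N)%:P * (g ^+ M)%:P * (u * v)
                        - (r%:P * d + b * s%:P + b * d * f) * f.
    rewrite mulrACA rE sE rmorphM /=; ring.
  by apply: dividesB => //; exact: divides_mull.
rewrite mulf_eq0 => /orP[/eqP r0|/eqP s0]; [left|right].
  by apply: (@g_regularX N); rewrite rE r0 add0r.
by apply: (@g_regularX M); rewrite sE s0 add0r.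
Qed.

End LinearPrime.

Lemma irreducible_iso (A B : comUnitRingType) (phi : {rmorphism A -> B})
    (psi : {rmorphism B -> A}) (a : A) :
  cancel phi psi -> cancel psi phi -> is_irreducible a -> is_irreducible (phi a).
Proof.
move=> phiK psiK [a0 aU airr]; split.
- by apply: contra_neq a0 => E; rewrite -[a]phiK E rmorph0.
- by apply: contra aU => /(rmorph_unit psi); rewrite phiK.
move=> u v /(congr1 psi); rewrite phiK rmorphM => /airr.
by case=> /(rmorph_unit phi); rewrite psiK; [left|right].
Qed.

Lemma prime_iso (A B : comNzRingType) (phi : {rmorphism A -> B})
    (psi : {rmorphism B -> A}) (a : A) :
  cancel phi psi -> prime_elt (phi a) -> prime_elt a.
Proof.
move=> phiK pa b c [w /(congr1 phi)]; rewrite !rmorphM => E.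
have [|[z /(congr1 psi)]|[z /(congr1 psi)]] := pa (phi b) (phi c); first by exists (phi w).
  by rewrite rmorphM !phiK => ->; left; exists (psi z).
by rewrite rmorphM !phiK => ->; right; exists (psi z).
Qed.

Lemma muni_sqf (n : nat) (K : fieldType) (f : {mpoly K[n.+1]}) :
  squarefree_supported f -> exists g h, [/\ squarefree_supported g,
    squarefree_supported h & muni f = h%:P + g%:P * 'X].
Proof.
move=> sqf; exists (muni f)`_1, (muni f)`_0.
have sq j : squarefree_supported (muni f)`_j.
  by move=> m /coef_muni_msupp[m' /sqf sm' [_ mE]] i; rewrite -mE.
split=> //; apply/polyP=> -[|[|j]]; rewrite coefD coefC coefMX coefC ?addr0 ?add0r //=.
apply/mpolyP=> m; rewrite mcoeff0; apply: memN_msupp_eq0; apply/negP.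
by move=> /coef_muni_msupp[m' /sqf/(_ ord_max) + [mE _]]; rewrite mE.
Qed.

Section LeadingCoefficientRegular.
Variables (n : nat) (K : fieldType).
Hypothesis sqf_prime : forall a : {mpoly K[n]},
  is_irreducible a -> squarefree_supported a -> prime_elt a.
Variables g h : {mpoly K[n]}.
Local Notation f := (h%:P + g%:P * 'X : {poly {mpoly K[n]}}).
Hypotheses (sqg : squarefree_supported g) (g0 : g != 0).
Hypothesis irr_f : is_irreducible f.

Lemma nonunit_msize (a : {mpoly K[n]}) :
  a != 0 -> a \isn't a GRing.unit -> (1 < msize a)%N.
Proof.
move=> a0 aU; rewrite ltnNge; apply: contra aU => /msize1_polyC aE.
exact/mpoly_unitP.
Qed.

(** Induction on the degree of a divisor [a] of [g]. An irreducible [a] is prime, also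
    after adjoining ['X], and cannot divide [f]; hence it divides the cofactor
    and can be cancelled. *)
Lemma factor_regular a b c : g = a * b -> divides f (a%:P * c) -> divides f c.
Proof.
have [s] := ubnP (msize a); elim: s => // s IH in a b c *; rewrite ltnS => le_as gE.
have [a0 b0] : a != 0 /\ b != 0.
  by apply/andP; rewrite -negb_or -mulf_eq0 -gE.
have sqa : squarefree_supported a by apply: (@sqf_factor _ _ _ b); rewrite -gE.
have [aU|aU] := boolP (a \is a GRing.unit).
  by move=> /(divides_mull (a^-1)%:P); rewrite mulrA -rmorphM mulVr // rmorph1 mul1r.
have [irr_a [w E]|] := pselect (is_irreducible a).
  have [||[w' wE]|[w' fE]] := @polyC_prime _ a _ w f.
  - exact: sqf_prime.
  - by rewrite -E mulrC; exists c.
  - exists w'; apply: (mulfI (x := a%:P)); first by rewrite polyC_eq0.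
    by rewrite E wE; ring.
  case: irr_f => _ _ /(_ _ _ fE) [w'U|/polyC_unit aU']; last by rewrite aU' in aU.
  have sw : size w' = 1 by move: w'U; rewrite poly_unitE => /andP[/eqP].
  have w'0 : w' != 0 by rewrite -size_poly_gt0 sw.
  (* a unit times the constant a has size 1, but f has size 2 *)
  have := size_linear h g0; rewrite fE size_mul ?polyC_eq0 // sw size_polyC a0.
  by [].
move=> nirr; have [a1 [a2 [aE U1 U2]]] : exists a1 a2,
    [/\ a = a1 * a2, a1 \isn't a GRing.unit & a2 \isn't a GRing.unit].
  apply: contrapT => nex; apply: nirr; split=> // u v aE.
  apply: contrapT => /not_orP[/negP uU /negP vU].
  by apply: nex; exists u, v.
have [a10 a20] : a1 != 0 /\ a2 != 0 by apply/andP; rewrite -negb_or -mulf_eq0 -aE.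
have := nonunit_msize a10 U1; have := nonunit_msize a20 U2.
move: le_as; rewrite aE msizeM // => le_s lt1 lt2.
have ltP x y : (1 < y)%N -> (1 < x)%N -> ((x + y).-1 <= s)%N ->
  (x < s)%N /\ (y < s)%N by lia.
rewrite rmorphM -mulrA => f1; apply: (IH a2 (a1 * b)).
- exact: (ltP _ _ lt1 lt2 le_s).2.
- by rewrite gE aE; ring.
apply: (IH a1 (a2 * b)) f1; first exact: (ltP _ _ lt1 lt2 le_s).1.
by rewrite gE aE; ring.
Qed.

Lemma leading_coef_regular c : divides f (g%:P * c) -> divides f c.
Proof. by apply: (@factor_regular g 1); rewrite mulr1. Qed.

End LeadingCoefficientRegular.

Lemma polyC_irreducible (n : nat) (K : fieldType) (h : {mpoly K[n]}) :
  is_irreducible (h%:P : {poly {mpoly K[n]}}) -> is_irreducible h.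
Proof.
move=> [h0 hU hirr]; split; first by rewrite -polyC_eq0.
  by apply: contra hU => /(rmorph_unit (@polyC {mpoly K[n]})).
by move=> u v /(congr1 (@polyC _)); rewrite rmorphM => /hirr[]/polyC_unit; [left|right].
Qed.

Lemma no_irreducible0 (K : fieldType) (f : {mpoly K[0]}) : ~ is_irreducible f.
Proof. by case=> f0 /negP fU _; apply: fU; apply/mpoly_unitP; split=> //; exact: mpoly0E. Qed.

(** The induction stays within squarefree supported polynomials: the leading
    coefficient in the last variable and its factors are again of this kind. *)
Theorem sqf_irreducible_prime (n : nat) (K : fieldType) (f : {mpoly K[n]}) :
  is_irreducible f -> squarefree_supported f -> prime_elt f.
Proof.
elim: n f => [|n IH] f irr_f sqf; first by case: (no_irreducible0 irr_f).
have := irreducible_iso (@muniK n K) (@uni_to_mpolyK n K) irr_f.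
have [g [h [sqg sqh fE]]] := muni_sqf sqf; rewrite /= fE => irr_gh.
apply: (prime_iso (@muniK n K)); rewrite /= fE.
have [g0|g0] := eqVneq g 0; last first.
  exact: linear_prime g0 (leading_coef_regular IH sqg g0 irr_gh).
move: irr_gh; rewrite g0 mul0r addr0 => /polyC_irreducible irr_h.
by apply: polyC_prime; exact: IH.
Qed.

(** * The splitting theorem *)

Section Splitting.
Variables (A : comNzRingType).
Implicit Types a c f : A.

Lemma splits_mul_unit (B : comUnitRingType) q (a u : B) :
  u \is a GRing.unit -> splits q a -> splits q (a * u).
Proof.
move=> uU [psi L E]; exists (fun x => psi (u^-1 * x)); first exact: frob_linear_premul.
by rewrite mulrCA mulVr // mulr1.
Qed.

(** A splitting up to a multiple of [f] can be corrected to a true one: since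
    [f * (c * f^(q-1)) = f^q * c], a splitting of [c] sends it to [f]. *)
Lemma splits_mod q c f d psi : (0 < q)%N -> frob_linear q psi ->
  psi (c * f ^+ q.-1) = 1 + f * d -> splits q c -> splits q (c * f ^+ q.-1).
Proof.
move=> q0 L E [psi2 L2 E2].
exists (fun x => psi x + (- d) * psi2 (f * x)).
  exact/frob_linear_combine/frob_linear_premul.
by rewrite [f * _]mulrCA -exprS prednK // [c * f ^+ q]mulrC (proj2 L2) E2 mulr1 E; ring.
Qed.

End Splitting.

Section LinearForms.
Variables (A : idomainType) (g h : A).
Local Notation f := (h%:P + g%:P * 'X : {poly A}).

Lemma size_linear_exp a k : (size (a%:P * f ^+ k)%R <= k.+1)%N.
Proof.
rewrite mul_polyC (leq_trans (size_scale_leq _ _)) //.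
rewrite (leq_trans (size_poly_exp_leq _ _)) // ltnS.
rewrite addrC -[k in leqRHS]mul1n leq_mul2r orbC.
by rewrite size_MXaddC; case: ifP => //; rewrite size_polyC; case: (g != 0).
Qed.

Lemma coef0_linear_exp a k : (a%:P * f ^+ k)`_0 = a * h ^+ k.
Proof.
by rewrite coefCM -horner_coef0 !hornerE.
Qed.

Lemma lead_linear_exp a k : g != 0 -> (a%:P * f ^+ k)`_k = a * g ^+ k.
Proof.
move=> g0; have lf : lead_coef f = g.
  by rewrite lead_coefE size_linear //= coefD coefC coefMX coefC add0r.
rewrite coefCM -{2}lf -lead_coef_exp lead_coefE.
by rewrite size_exp size_linear // mul1n.
Qed.

End LinearForms.

Section CoefficientExtraction.
Variables (A : idomainType) (p : nat).
Hypothesis charA : p \in [pchar A].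
Variables (g h c' : A) (c b : {poly A}) (N e : nat).
Local Notation f := (h%:P + g%:P * 'X : {poly A}).
Local Notation q := (p ^ e)%N.
Hypothesis g0 : g != 0.
Hypothesis cE : (g ^+ N)%:P * c = c'%:P + b * f.

(** Multiplied by [g^N], the element [c] is congruent to the constant [c'] modulo [f].
    In [c' f^(q-1)] the top coefficient is [c' g^(q-1)], and one more factor [g]
    makes it [g^q c'], which [psi] sends to [g]. *)
Lemma reduce_to_leading_coef psi : frob_linear q psi -> psi c' = 1 ->
  lift_poly p e q.-1 psi ((g ^+ N.+1)%:P * (c * f ^+ q.-1))
    = g%:P + f * lift_poly p e q.-1 psi (g%:P * b).
Proof.
move=> L psic; have q0 := pexp_gt0 e charA.
have [LD LM] : frob_linear q (lift_poly p e q.-1 psi).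
  by apply: lift_poly_frob_linear => //; rewrite prednK.
have -> : (g ^+ N.+1)%:P * (c * f ^+ q.-1)
    = (g * c')%:P * f ^+ q.-1 + f ^+ q * (g%:P * b).
  have -> : f ^+ q = f * f ^+ q.-1 by rewrite -exprS prednK.
  rewrite exprS polyCM -mulrA.
  rewrite [_%:P * (c * _)]mulrA cE rmorphM /=; ring.
rewrite LD LM; congr (_ + _); apply/polyP=> j; rewrite coef_lift_poly // coefC.
case: j => [|j] /=.
  rewrite mul0n addn0 lead_linear_exp // mulrAC -exprS prednK //.
  by rewrite (proj2 L) psic mulr1.
rewrite nth_default ?(frob_linear0 L) // (leq_trans (size_linear_exp _ _ _ _)) //.
by rewrite mulSn addnA -addn1 (leq_trans _ (leq_addr _ _)) // leq_add2l.
Qed.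

End CoefficientExtraction.

Lemma splits_shift (A : comNzRingType) q (g h T : A) k :
  splits q (g%:P * ((h + T * g)%:P + g%:P * 'X) ^+ k) ->
  splits q (g%:P * (h%:P + g%:P * 'X) ^+ k).
Proof.
have shiftK : cancel (comp_poly ('X + T%:P)) (comp_poly ('X - T%:P)).
  by move=> u; exact: (comp_polyXaddC_K u T).
move=> s; apply: (splits_iso (f := comp_poly ('X + T%:P)) shiftK).
rewrite rmorphM rmorphXn rmorphD rmorphM /= !comp_polyC comp_polyX.
suff -> : h%:P + g%:P * ('X + T%:P) = (h + T * g)%:P + g%:P * 'X by [].
by rewrite rmorphD rmorphM /=; ring.
Qed.

Section FunctionField.
Variables (K : fieldType).

Definition fun_field : fieldType := {fraction {poly K}}.

Definition to_fun_field : {rmorphism K -> fun_field} :=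
  @tofrac {poly K} \o @polyC K.

Definition fun_field_var : fun_field := tofrac ('X : {poly K}).

Lemma fun_field_var_free (a b c : K) :
  to_fun_field a * fun_field_var ^+ 2 + to_fun_field b * fun_field_var
    + to_fun_field c = 0 -> [/\ a = 0, b = 0 & c = 0].
Proof.
rewrite /= -tofracXn -!tofracM -!tofracD => /eqP; rewrite tofrac_eq0 => /eqP E.
have cE j : (a%:P * 'X^2 + b%:P * 'X + c%:P)`_j = 0 by rewrite E coef0.
move: (cE 0%N) (cE 1%N) (cE 2%N).
by rewrite !coefD !coefCM !coefXn !coefX !coefC /= !(mulr0, mulr1, addr0, add0r).
Qed.

End FunctionField.

(** After the shift of ['X] by [t], the constant coefficient of [g f^(q-1)] is the
    element assumed to split, and the degree is less than [q]. *)
Lemma splits_linear_of_pencil (n : nat) (K M : fieldType) (p e : nat)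
    (i : {rmorphism K -> M}) (t : M) (g h : {mpoly K[n]}) : p \in [pchar K] ->
  splits (p ^ e) (map_mpoly i g * pencil i t g h ^+ (p ^ e).-1) ->
  splits (p ^ e) (g%:P * (h%:P + g%:P * 'X) ^+ (p ^ e).-1).
Proof.
move=> charK sF; have charM : p \in [pchar M] by exact: (rmorph_pchar i).
have charA : p \in [pchar {mpoly M[n]}] by exact: (rmorph_pchar (@mpolyC n M)).
have q0 := pexp_gt0 e charM.
have [rho /(retraction_mpoly n)[rho1 /retraction_poly[rho2 R2]]] := field_retraction i.
apply: (splits_retraction R2); rewrite rmorphM rmorphXn rmorphD rmorphM /=.
rewrite !map_polyC map_polyX /=; apply: (splits_shift (T := t%:MP)).
apply: (@poly_splits_coef _ _ _ 0) => //.
  by rewrite add0n (leq_trans (size_linear_exp _ _ _ _)) // prednK.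
by rewrite coef0_linear_exp mul_mpolyC.
Qed.

Section PencilSplitting.
Variables (n : nat) (K : fieldType) (p : nat).
Hypothesis charK : p \in [pchar K].
Variables (g h : {mpoly K[n]}).
Local Notation f := (h%:P + g%:P * 'X : {poly {mpoly K[n]}}).
Local Notation M := (fun_field K).
Local Notation i := (to_fun_field K).
Local Notation t := (fun_field_var K).

Hypothesis IH : forall (f c : {mpoly M[n]}), is_irreducible f ->
  squarefree_supported f -> ~ divides f c ->
  forall e0, exists2 e, (e0 <= e)%N & splits (p ^ e) (c * f ^+ (p ^ e).-1).
Hypotheses (sqg : squarefree_supported g) (sqh : squarefree_supported h).
Hypothesis irr_f : is_irreducible f.
Hypothesis g0 : g != 0.

Lemma splits_leading_coef : exists e, splits (p ^ e) (g%:P * f ^+ (p ^ e).-1).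
Proof.
have charM : p \in [pchar M] by exact: (rmorph_pchar i).
have tP := @fun_field_var_free K.
have [FU|FU] := boolP (pencil i t g h \is a GRing.unit).
  have [|e sG] := @mpoly_splits M p n (map_mpoly i g) charM.
    apply: contra_neq g0 => G0; apply/mpolyP=> m; apply: (fmorph_inj i).
    by rewrite -mcoeff_map_mpoly G0 !mcoeff0 rmorph0.
  exists e; apply: (splits_linear_of_pencil (i := i) (t := t)) => //.
  by apply: splits_mul_unit; [exact: unitrX|exact: sG].
have [|||e _ sF] := @IH (pencil i t g h) (map_mpoly i g) _ _ _ 0%N.
- exact: pencil_irreducible.
- exact: pencil_sqf.
- by case=> w; exact: pencil_ndvd.
by exists e; exact: (splits_linear_of_pencil (i := i) (t := t)).
Qed.

(** Two splittings are composed: a [p^e]-linear one reduces [c] to [g], and a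
    [p^d]-linear one splits [g * f^(p^d - 1)]. The exponent [e] is free, which
    gives arbitrarily large powers. *)
Lemma splits_linear (c : {poly {mpoly K[n]}}) e0 : ~ divides f c ->
  exists2 e, (e0 <= e)%N & splits (p ^ e) (c * f ^+ (p ^ e).-1).
Proof.
move=> nfc; have charA : p \in [pchar {mpoly K[n]}].
  exact: (rmorph_pchar (@mpolyC n K)).
have regular c' : divides f (g%:P * c') -> divides f c'.
  apply: leading_coef_regular => //; exact: sqf_irreducible_prime.
have [N [c' [b cE]]] := pseudo_division g h c.
have c'0 : c' != 0.
  apply: contra_notN nfc => /eqP c'0; apply: (g_regularX regular (N := N)).
  by exists b; rewrite cE c'0 add0r.
have c0 : uni_to_mpoly n K c != 0.
  apply: contra_notN nfc => /eqP c0; rewrite -[c]uni_to_mpolyK c0 muni0.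
  exact: divides0.
have [d [psi0 L0 E0]] := splits_leading_coef.
have [e1 sc'] := mpoly_splits charK c'0.
have [e2 sc] := mpoly_splits charK c0.
pose e := maxn e0 (maxn e1 e2).
have le_e1 : (e1 <= e)%N by rewrite !leq_max leqnn !orbT.
have le_e2 : (e2 <= d + e)%N by rewrite (leq_trans _ (leq_addl _ _)) // !leq_max leqnn !orbT.
exists (d + e)%N; first by rewrite (leq_trans _ (leq_addl _ _)) // leq_max leqnn.
have [psi1 L1 E1] := sc' e le_e1.
have q0 := pexp_gt0 e charA.
pose lam := lift_poly p e (p ^ e).-1 psi1.
have lamL : frob_linear (p ^ e) lam.
  by apply: lift_poly_frob_linear => //; rewrite prednK.
have lamE := reduce_to_leading_coef charA g0 cE L1 E1.
apply: (splits_mod (psi := fun z => psi0 (lam ((g ^+ N.+1)%:P * z)))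
   (d := psi0 (lam (g%:P * b)))).
- exact: (pexp_gt0 _ charA).
- by rewrite expnD; apply: frob_linear_comp => //; exact: frob_linear_premul.
- have -> : (g ^+ N.+1)%:P * (c * f ^+ (p ^ (d + e)).-1) =
      (f ^+ (p ^ d).-1) ^+ (p ^ e) * ((g ^+ N.+1)%:P * (c * f ^+ (p ^ e).-1)).
    have -> : f ^+ (p ^ (d + e)).-1 = (f ^+ (p ^ d).-1) ^+ (p ^ e) * f ^+ (p ^ e).-1.
      rewrite -exprM -exprD; congr (f ^+ _).
      have qd := pexp_gt0 d charA.
      by rewrite expnD -{1}(prednK qd) mulSn; lia.
    by ring.
  rewrite (proj2 lamL) /lam lamE mulrDr (proj1 L0) mulrC E0; congr (_ + _).
  by rewrite mulrA -exprSr prednK ?(proj2 L0) // (pexp_gt0 _ charA).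
apply: (splits_iso (f := uni_to_mpoly n K) (@uni_to_mpolyK n K)).
exact: sc.
Qed.

End PencilSplitting.

(** Strong F-regularity of the hypersurface [f = 0], in the form of Fedder's
    criterion. The field varies in the induction, because freezing a variable
    adjoins a transcendental to it. *)
Theorem sqf_irreducible_splits (n : nat) (K : fieldType) (p : nat) (f c : {mpoly K[n]}) :
  p \in [pchar K] -> is_irreducible f -> squarefree_supported f -> ~ divides f c ->
  forall e0, exists2 e, (e0 <= e)%N & splits (p ^ e) (c * f ^+ (p ^ e).-1).
Proof.
elim: n K f c => [|n IH] K f c charK irr_f sqf nfc e0.
  by case: (no_irreducible0 irr_f).
have := irreducible_iso (@muniK n K) (@uni_to_mpolyK n K) irr_f.
have [g [h [sqg sqh fE]]] := muni_sqf sqf; rewrite /= fE => irr_gh.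
have charA : p \in [pchar {mpoly K[n]}] by exact: (rmorph_pchar (@mpolyC n K)).
have nfc' : ~ divides (h%:P + g%:P * 'X) (muni c).
  by rewrite -fE => /muni_divides.
suff [e le_e se] : exists2 e, (e0 <= e)%N &
    splits (p ^ e) (muni c * (h%:P + g%:P * 'X) ^+ (p ^ e).-1).
  exists e => //; apply: splits_muni.
  by rewrite rmorphM rmorphXn /= fE.
have [g0|g0] := eqVneq g 0; last first.
  apply: splits_linear => // f' c' irr' sq' nf' e'.
  apply: IH => //; exact: (rmorph_pchar (to_fun_field K)).
move: irr_gh nfc'; rewrite g0 mul0r addr0 => /polyC_irreducible irr_h.
case/polyC_ndivides=> j nj _.
have [e le_e se] := IH K h (muni c)`_j charK irr_h sqh nj (maxn e0 (size (muni c))).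
move: le_e; rewrite geq_max => /andP[le_e le_s].
have lt_s : (size (muni c) < p ^ e)%N.
  by apply: leq_ltn_trans le_s _; rewrite ltn_expl // prime_gt1 // (pcharf_prime charK).
exists e => //; rewrite -rmorphXn /=; apply: (@poly_splits_coef _ _ _ j) => //.
- apply: leq_trans (ltnW lt_s); rewrite ltnNge; apply/negP=> le_j.
  by apply: nj; rewrite nth_default //; exact: divides0.
- rewrite mulrC mul_polyC (leq_trans (size_scale_leq _ _)) //.
  by rewrite (leq_trans (ltnW lt_s)) // leq_addl.
by rewrite coefMC.
Qed.

(** * Noetherian rings and quotients *)

Section Ideals.
Variable A : comNzRingType.
Implicit Types (I J : set A) (s : seq A).

Lemma ideal_gen_ideal (B : set A) : is_ideal (ideal_gen B).
Proof.
split=> [J [[]]|x y Jx Jy J JP|a x Jx J JP] //.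
  by case: (JP) => -[_ JD _] _; apply: JD; [exact: Jx|exact: Jy].
by case: (JP) => -[_ _ JM] _; apply: JM; exact: Jx.
Qed.

Lemma ideal_gen_mem (B : set A) x : B x -> ideal_gen B x.
Proof. by move=> Bx J [_]; exact. Qed.

Lemma ideal_gen_min (B I : set A) :
  is_ideal I -> (forall x, B x -> I x) -> forall x, ideal_gen B x -> I x.
Proof. by move=> iI BI x; apply. Qed.

Lemma ideal_gen1 (f x : A) : ideal_gen [set f]%classic x <-> divides f x.
Proof.
split=> [|[w ->]]; last first.
  by have [_ _ M] := ideal_gen_ideal [set f]%classic; apply: M; exact: ideal_gen_mem.
apply: (ideal_gen_min (I := fun y => divides f y)) => [|_ ->]; last by exists 1; rewrite mul1r.
by split; [exact: divides0|exact: dividesD|exact: divides_mull].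
Qed.

(** Phrasing generation through the ideals containing [s] avoids linear combinations
    and makes transport along morphisms immediate. *)
Definition generates s I := (forall x, x \in s -> I x) /\
  forall J, is_ideal J -> (forall x, x \in s -> J x) -> forall x, I x -> J x.

Lemma noetherianP :
  noetherian A <-> forall I, is_ideal I -> exists s, generates s I.
Proof.
split=> noeA I iI; have [s] := noeA I iI.
  move=> ->; exists s; split=> [x xs|J iJ sJ]; first exact: ideal_gen_mem.
  exact: ideal_gen_min.
move=> [sI sJ]; exists s; apply/seteqP; split=> x.
  by apply: sJ => [|y ys]; [exact: ideal_gen_ideal|exact: ideal_gen_mem].
exact: ideal_gen_min.
Qed.

End Ideals.

Lemma noetherian_surjective (A B : comNzRingType) (phi : {rmorphism A -> B}) :
  (forall y, exists x, phi x = y) -> noetherian A -> noetherian B.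
Proof.
move=> surj /noetherianP noeA; apply/noetherianP => I [I0 ID IM].
have preI J : is_ideal J -> is_ideal (fun x => J (phi x)).
  move=> [J0 JD JM]; split=> [|x y Jx Jy|a x Jx]; rewrite ?rmorph0 //.
    by rewrite rmorphD; exact: JD.
  by rewrite rmorphM; exact: JM.
have [|s [sI sJ]] := noeA (fun x => I (phi x)); first exact: preI.
exists (map phi s); split=> [_ /mapP[x xs ->]|J iJ Js y]; first exact: sI.
have [x <-] := surj y; apply: (sJ (fun x => J (phi x))); first exact: preI.
by move=> z zs; apply: Js; exact: map_f.
Qed.

Lemma field_noetherian (K : fieldType) : noetherian K.
Proof.
apply/noetherianP => I [I0 ID IM].
have [[a [Ia a0]]|nI] := pselect (exists a, I a /\ a != 0).
  exists [:: 1]; split=> [x|J [_ _ JM] J1 x _].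
    by rewrite inE => /eqP ->; rewrite -(mulVf a0); exact: IM.
  by rewrite -[x]mulr1; apply: JM; apply: J1; rewrite inE.
exists [::]; split=> // J [J0 _ _] _ x Ix.
suff -> : x = 0 by [].
by apply: contrapT => /eqP x0; apply: nI; exists x.
Qed.

Section HilbertBasis.
Variable A : comNzRingType.
Implicit Types (I J : set {poly A}) (d : nat).

Definition coef_ideal I d : set A :=
  fun a => exists u, [/\ I u, (size u <= d.+1)%N & u`_d = a].

Lemma coef_ideal_ideal I d : is_ideal I -> is_ideal (coef_ideal I d).
Proof.
move=> [I0 ID IM]; split=> [|_ _ [u [Iu su <-]] [v [Iv sv <-]]|a _ [u [Iu su <-]]].
- by exists 0; rewrite size_poly0 coef0.
- exists (u + v); rewrite coefD; split=> //; first exact: ID.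
  by rewrite (leq_trans (size_polyD _ _)) // geq_max su.
exists (a%:P * u); rewrite coefCM; split=> //; first exact: IM.
by rewrite mul_polyC (leq_trans (size_scale_leq _ _)).
Qed.

Lemma coef_ideal_mono I d e a : is_ideal I -> (d <= e)%N ->
  coef_ideal I d a -> coef_ideal I e a.
Proof.
move=> [_ _ IM] /subnK <- [u [Iu su <-]]; exists ('X^(e - d) * u); split.
- exact: IM.
- rewrite (leq_trans (size_polyMleq _ _)) // size_polyXn addSn /=.
  by rewrite -addnS leq_add2l.
by rewrite coefXnM ltnNge leq_addr addKn.
Qed.

(** The ideals of leading coefficients in degree at most [d] increase with [d] and
    stabilize at some [N]. Lifting generators of those of degree at most [N] gives
    [G]; an ideal [J] containing [G] has, together with [I], the same ideals of
    leading coefficients as [I], and this forces [I] to be contained in [J]. *)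
Theorem hilbert_basis : noetherian A -> noetherian {poly A}.
Proof.
move=> /noetherianP noeA; apply/noetherianP => I iI; have [I0 ID IM] := iI.
pose Linf : set A := fun a => exists d, coef_ideal I d a.
have iL d := coef_ideal_ideal d iI.
have iLinf : is_ideal Linf.
  split=> [|x y [d Lx] [e Ly]|a x [d Lx]].
  - by exists 0%N; case: (iL 0%N).
  - exists (maxn d e); have [_ D _] := iL (maxn d e).
    apply: D; [apply: coef_ideal_mono Lx|apply: coef_ideal_mono Ly] => //.
      exact: leq_maxl.
    exact: leq_maxr.
  - by exists d; have [_ _ M] := iL d; exact: M.
have [s [sL sJ]] := noeA _ iLinf.
have [N sN] : exists N, forall x, x \in s -> coef_ideal I N x.
  elim: s sL {sJ} => [|x s IH] sL; first by exists 0%N.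
  have [|N sN] := IH; first by move=> y ys; apply: sL; rewrite inE ys orbT.
  have [d Lx] := sL x (mem_head _ _).
  exists (maxn d N) => y; rewrite inE => /orP[/eqP ->|/sN].
    by apply: coef_ideal_mono Lx => //; exact: leq_maxl.
  by apply: coef_ideal_mono => //; exact: leq_maxr.
have LN a d : coef_ideal I d a -> coef_ideal I N a.
  by move=> La; apply: (sJ _ (iL N) sN); exists d.
have [S SP] := choice (fun d => noeA _ (iL d)).
have wit d a : exists u, coef_ideal I d a -> [/\ I u, (size u <= d.+1)%N & u`_d = a].
  by have [[u uP]|nL] := pselect (coef_ideal I d a); [exists u|exists 0].
have [P PP] := choice (fun da : nat * A => wit da.1 da.2).
pose G := [seq P (d, a) | d <- iota 0 N.+1, a <- S d].
exists G; split=> [_ /allpairsPdep[d [a [_ aS ->]]]|J iJ GJ].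
  by case: (PP (d, a)) => //; exact: (SP d).1.
pose IJ : set {poly A} := fun u => I u /\ J u.
have iIJ : is_ideal IJ.
  have [J0 JD JM] := iJ; split=> [//|x y [Ix Jx] [Iy Jy]|a x [Ix Jx]].
    by split; [exact: ID|exact: JD].
  by split; [exact: IM|exact: JM].
have L_IJ d a : coef_ideal I d a -> coef_ideal IJ d a.
  have le_N e b : (e <= N)%N -> coef_ideal I e b -> coef_ideal IJ e b.
    move=> le_eN; apply: (SP e).2; first exact: coef_ideal_ideal.
    move=> x xS; have [/= Ix sx xE] := PP (e, x) ((SP e).1 x xS).
    exists (P (e, x)); split=> //; split=> //; apply: GJ.
    by apply/allpairsPdep; exists e, x; split=> //; rewrite mem_iota.
  have [|/ltnW le_Nd] := leqP d N; first exact: le_N.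
  by move=> /LN/(le_N _ _ (leqnn N)); exact: coef_ideal_mono.
move=> u; have [k] := ubnP (size u); elim: k u => // k IH u; rewrite ltnS => le_uk Iu.
have [J0 JD JM] := iJ.
have [->|u0] := eqVneq u 0; first exact: J0.
have su : (size u).-1.+1 = size u by rewrite prednK // size_poly_gt0.
have [|v [[Iv Jv] sv vE]] := L_IJ (size u).-1 (lead_coef u).
  by exists u; split=> //; rewrite su.
rewrite -[u](subrK v); apply: JD => //; apply: IH; last first.
  by apply: ID => //; rewrite -mulN1r; exact: IM.
apply: leq_trans le_uk; rewrite -su ltnS; apply/leq_sizeP => j.
rewrite leq_eqVlt => /orP[/eqP <-|lt_j]; rewrite coefB; first by rewrite vE subrr.
by rewrite !nth_default ?subrr // ?(leq_trans sv) // -su.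
Qed.

End HilbertBasis.

Lemma mpoly_noetherian (n : nat) (K : fieldType) : noetherian {mpoly K[n]}.
Proof.
elim: n => [|n IH].
  apply: (noetherian_surjective (phi := @mpolyC 0 K)); last exact: field_noetherian.
  by move=> u; exists (u@_0%MM); apply: esym; exact: mpoly0E.
apply: (noetherian_surjective (phi := uni_to_mpoly n K)); last exact: hilbert_basis.
by move=> u; exists (muni u); rewrite muniK.
Qed.

Section QuotientRing.
Variables (A : comNzRingType) (I : set A) (pI : is_proper_ideal I).
Local Notation pi := (quotient_map pI).

Lemma quotient_map_surj y : exists x, pi x = y.
Proof. by exists (repr y); rewrite /quotient_map /= reprK. Qed.

Lemma quotient_map_eq0 x : pi x = 0 <-> I x.
Proof.
rewrite -(rmorph0 pi) /quotient_map /=.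
split=> [/eqP|Ix].
  by rewrite -Quotient.idealrBE subr0 unfold_in => /asboolP.
by apply/eqP; rewrite -Quotient.idealrBE subr0 unfold_in; apply/asboolP.
Qed.

Lemma quotient_lift (C : comNzRingType) (phi : {rmorphism A -> C}) :
  (forall x, I x -> phi x = 0) ->
  exists psi : {rmorphism quotient_ring pI -> C}, forall x, psi (pi x) = phi x.
Proof.
move=> phi0; pose psi (z : quotient_ring pI) : C := phi (repr z).
have psiE x : psi (pi x) = phi x.
  apply/eqP; rewrite -subr_eq0 -rmorphB; apply/eqP/phi0/quotient_map_eq0.
  by rewrite rmorphB /= reprK subrr.
have psiB : zmod_morphism psi.
  move=> y z; have [u <-] := quotient_map_surj y; have [v <-] := quotient_map_surj z.
  by rewrite -rmorphB !psiE rmorphB.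
have psiM : monoid_morphism psi.
  split; first by rewrite -(rmorph1 pi) psiE rmorph1.
  move=> y z; have [u <-] := quotient_map_surj y; have [v <-] := quotient_map_surj z.
  by rewrite -rmorphM !psiE rmorphM.
pose hB := GRing.isZmodMorphism.Build _ _ psi psiB.
pose hM := GRing.isMonoidMorphism.Build _ _ psi psiM.
pose psi' : {rmorphism quotient_ring pI -> C} := HB.pack psi hB hM.
by exists psi'.
Qed.

End QuotientRing.

(** * Tight closure and base change *)

Section TightClosure.
Variables (S R : comNzRingType) (pi : {rmorphism S -> R}) (f : S) (p : nat).
Hypothesis pi_surj : forall y, exists x, pi x = y.
Hypothesis pi_ker : forall x, pi x = 0 <-> divides f x.
Hypothesis prime_f : prime_elt f.
Hypothesis p_gt0 : (0 < p)%N.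
Hypothesis f_splits : forall c, ~ divides f c ->
  forall e0, exists2 e, (e0 <= e)%N & splits (p ^ e) (c * f ^+ (p ^ e).-1).

Lemma zero_prime : is_prime_ideal (fun x : R => x = 0).
Proof.
split.
  split; last by move/eqP; rewrite oner_eq0.
  by split=> [//|x y -> ->|a x ->]; rewrite ?addr0 ?mulr0.
move=> x y; have [u <-] := pi_surj x; have [v <-] := pi_surj y.
by rewrite -rmorphM => /pi_ker/prime_f[] /pi_ker; [left|right].
Qed.

Lemma zero_minimal_prime : is_minimal_prime (fun x : R => x = 0).
Proof.
split=> [|Q [[[Q0 _ _] _] _] Qsub]; first exact: zero_prime.
by apply/seteqP; split=> [x /Qsub //|x ->].
Qed.

Lemma sub_tight_closure (I : set R) x : I x -> tight_closure p I x.
Proof.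
move=> Ix; exists 1; split=> [P [[[_ nP1] _] _] //|]; exists 0%N => e _.
by rewrite mul1r; apply: ideal_gen_mem; exists x.
Qed.

(** The set [W] of classes of those [w] for which [f^(q-1) w] is mapped into [I] by
    all premultiples of [psi] is an ideal that contains the Frobenius power of
    [I]. It therefore contains [c x^q], while [psi] maps [f^(q-1) c x^q] to [x]. *)
Lemma tight_closure_sub (I : set R) x : is_ideal I -> tight_closure p I x -> I x.
Proof.
move=> [I0 ID IM] [c [c_min [e0 c_tight]]].
have [u uE] := pi_surj x; have [d dE] := pi_surj c.
have nfd : ~ divides f d.
  by move/pi_ker; rewrite dE; exact: (c_min _ zero_minimal_prime).
have [e le_e [psi L psiE]] := f_splits nfd e0; have [D M] := L.
have q0 : (0 < p ^ e)%N by rewrite expn_gt0 p_gt0.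
pose W : set R := fun z => exists w, pi w = z
  /\ forall a, I (pi (psi (f ^+ (p ^ e).-1 * (a * w)))).
have fq w : psi (f ^+ (p ^ e).-1 * (w * f)) = f * psi w.
  by rewrite mulrCA -exprSr prednK // mulrC M.
have pif w : pi (f * w) = 0 by apply/pi_ker; exists w; rewrite mulrC.
have iW : is_ideal W.
  split=> [|_ _ [w [<- wI]] [v [<- vI]]|a _ [w [<- wI]]].
  - by exists 0; rewrite rmorph0; split=> // a; rewrite !mulr0 (frob_linear0 L) rmorph0.
  - exists (w + v); rewrite rmorphD; split=> // a.
    by rewrite !mulrDr D rmorphD; exact: ID.
  - have [b <-] := pi_surj a; exists (b * w); rewrite rmorphM; split=> // a'.
    by rewrite [a' * _]mulrA.
have WI : forall z, frobenius_power I (p ^ e) z -> W z.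
  apply: ideal_gen_min => // _ [y Iy <-]; have [v vE] := pi_surj y.
  exists (v ^+ (p ^ e)); rewrite rmorphXn vE; split=> // a.
  by rewrite mulrA mulrC M rmorphM vE mulrC; exact: IM.
have [w [wE /(_ 1)]] := WI _ (c_tight e le_e); rewrite mul1r => wI.
have [b bE] : divides f (d * u ^+ (p ^ e) - w).
  by apply/pi_ker; rewrite rmorphB rmorphM rmorphXn uE dE wE subrr.
have : u = psi (f ^+ (p ^ e).-1 * w) + f * psi b.
  rewrite -fq -bE -D -mulrDr addrCA subrr addr0 mulrA mulrC M.
  by rewrite [_ * d]mulrC psiE mulr1.
by move/(congr1 pi); rewrite rmorphD pif addr0 uE => ->.
Qed.

Lemma tight_closure_trivial (I : set R) : is_ideal I -> tight_closure p I = I.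
Proof.
move=> iI; apply/seteqP; split=> x; first exact: tight_closure_sub.
exact: sub_tight_closure.
Qed.

End TightClosure.

Section HypersurfaceRing.
Variables (n : nat) (K : fieldType) (f : {mpoly K[n]}) (irr_f : is_irreducible f).
Local Notation pi := (quotient_map (irreducible_proper irr_f)).

Lemma hypersurface_ker x : pi x = 0 <-> divides f x.
Proof. by split=> [/quotient_map_eq0/ideal_gen1|/ideal_gen1/quotient_map_eq0]. Qed.

Lemma hypersurface_F_rational p : p \in [pchar K] -> squarefree_supported f ->
  F_rational p (hypersurface_ring irr_f).
Proof.
move=> charK sqf; split.
- exact: (rmorph_pchar (hypersurface_coef irr_f)).
- apply: (noetherian_surjective (phi := pi)); first exact: quotient_map_surj.
  exact: mpoly_noetherian.
move=> I [s [-> _]]; apply: (tight_closure_trivial (pi := pi) (f := f)).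
- exact: quotient_map_surj.
- exact: hypersurface_ker.
- exact: sqf_irreducible_prime.
- exact/prime_gt0/(pcharf_prime charK).
- by move=> c; exact: sqf_irreducible_splits.
exact: ideal_gen_ideal.
Qed.

End HypersurfaceRing.

Section BaseChange.
Variables (n : nat) (K L : fieldType) (i : {rmorphism K -> L}) (f : {mpoly K[n]}).
Variables (irr_f : is_irreducible f) (irr_F : is_irreducible (map_mpoly i f)).
Local Notation piK := (quotient_map (irreducible_proper irr_f)).
Local Notation piL := (quotient_map (irreducible_proper irr_F)).

(** A pair of compatible morphisms from [S/(f)] and from [L] is the same as a morphism
    from [L[x]] vanishing at [f]: the images of the variables come from [S/(f)]. *)
Lemma hypersurface_base_change :
  exists u : {rmorphism hypersurface_ring irr_f -> hypersurface_ring irr_F},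
  is_tensor_product (hypersurface_coef irr_f) i u (hypersurface_coef irr_F).
Proof.
have [u uE] : exists u : {rmorphism hypersurface_ring irr_f -> hypersurface_ring irr_F},
    forall x, u (piK x) = piL (map_mpoly i x).
  apply: (@quotient_lift _ _ _ _ (piL \o map_mpoly i)) => x /ideal_gen1[w ->].
  by rewrite /= rmorphM; apply/hypersurface_ker; exists (map_mpoly i w).
exists u; split=> [k|C phi psi phi_psi].
  by rewrite [hypersurface_coef irr_f k]/= uE map_mpolyC.
pose chi : {rmorphism {mpoly L[n]} -> C} := mmap psi (fun j => phi (piK 'X_j)).
have chi_map x : chi (map_mpoly i x) = phi (piK x).
  apply: (mpoly_rmorph_ext (f := chi \o map_mpoly i) (g := phi \o piK)) => [c|j] /=.
    by rewrite map_mpolyC mmapC; exact: esym (phi_psi c).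
  by rewrite map_mpolyX mmapX mmap1U.
have chi0 x : ideal_gen [set map_mpoly i f]%classic x -> chi x = 0.
  move=> /ideal_gen1[w ->]; rewrite rmorphM chi_map.
  have -> : piK f = 0 by apply/hypersurface_ker; exists 1; rewrite mul1r.
  by rewrite rmorph0 mulr0.
have [eta etaE] := quotient_lift (irreducible_proper irr_F) chi0.
exists eta; split=> [x|y|eta' eta'u eta'v x].
- have [w <-] := quotient_map_surj x; by rewrite uE etaE chi_map.
- by rewrite [hypersurface_coef irr_F y]/= etaE /= mmapC.
have [w <-] := quotient_map_surj x; rewrite etaE.
apply: (mpoly_rmorph_ext (f := eta' \o piL) (g := chi)) => [c|j] /=.
  by rewrite mmapC; exact: eta'v.
by rewrite mmapX mmap1U -(map_mpolyX i) -uE eta'u.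
Qed.

End BaseChange.

Theorem corollary2p15 (K : fieldType) (p : nat) (charK : p \in [pchar K])
    (n : nat) (f : {mpoly K[n]}) (irr_f : is_irreducible f)
    (sqf_f : squarefree_supported f) :
  geometrically_F_rational p (hypersurface_coef irr_f).
Proof.
move=> L i; have irr_F := map_mpoly_irreducible i irr_f sqf_f.
have [u uP] := hypersurface_base_change irr_f irr_F.
exists (hypersurface_ring irr_F), u, (hypersurface_coef irr_F); split=> //.
apply: hypersurface_F_rational; first exact: (rmorph_pchar i).
move=> m; rewrite mcoeff_msupp mcoeff_map_mpoly fmorph_eq0 -mcoeff_msupp.
exact: sqf_f.
Qed.
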